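(* Let $k,a,b,r$ be integers with $k\geq b>a\geq 1$ and $r\geq 1$. Let $\mathcal{P}_{a,b,k,r}$ (resp. $\mathcal{P}'_{a,b,k,r}$) be the set of partitions $\pi=(\pi_1,\ldots,\pi_m)$, $\pi_1\geq\cdots\geq\pi_m\geq 1$ (including the empty partition), such that every part is congruent to $a$ or $b$ modulo $k$, and there is no index $i$ with $\pi_i,\pi_{i+1},\ldots,\pi_{i+r}$ all congruent to $b$ (resp. all congruent to $a$) modulo $k$. Then \begin{align*} &\sum_{\pi\in\mathcal{P}_{a,b,k,r}}\mu^{\ell_{k,a}(\pi)}\nu^{\ell_{k,b}(\pi)}q^{|\pi|}\\ &=1+\sum_{m\geq 1}\frac{1}{(q^k;q^k)_m}\Bigg(\mu^mq^{ma}+\sum_{s\geq 1}\sum_{h\geq 0}\mu^{m-h-s}\nu^{h+s}q^{(m-h-s)a+(h+s)b+k(s^2-s)}{{m-h-s+1}\brack {s}}_{k}\\ &\qquad\qquad\times\sum_{i\geq 0}(-1)^iq^{rk(i^2-i)/2}{{s}\brack {i}}_{rk}{{h-ri+s-1}\brack {s-1}}_{k}\Bigg), \end{align*} and \begin{align*} &\sum_{\pi\in\mathcal{P}'_{a,b,k,r}}\mu^{\ell_{k,a}(\pi)}\nu^{\ell_{k,b}(\pi)}q^{|\pi|}\\ &=1+\sum_{m\geq 1}\frac{1}{(q^k;q^k)_m}\Bigg\{\nu^mq^{mb}+\sum_{s\geq 1}\sum_{h\geq 0}\mu^{h+s}\nu^{m-h-s}q^{(h+s)a+(m-h-s)b+k(s-1)^2}\\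 &\qquad\times\left({{m-h-s}\brack {s-1}}_{k}+q^{k(h+2s-1)}{{m-h-s}\brack {s}}_{k}\right)\sum_{i\geq 0}(-1)^iq^{rk(i^2-i)/2}{{s}\brack {i}}_{rk}{{h-ri+s-1}\brack {s-1}}_{k}\Bigg\}. \end{align*}
   Context: Partitions are finite non-increasing sequences of positive integers; $|\pi|$ is the sum of the parts; for $k\geq d\geq 1$, $\ell_{k,d}(\pi)$ denotes the number of parts of $\pi$ congruent to $d$ modulo $k$. $|q|<1$. $(x;q)_0=1$, $(x;q)_n=(1-x)(1-xq)\cdots(1-xq^{n-1})$. For a positive integer $k$ and integers $A,B$, ${A\brack B}_k=\frac{(q^k;q^k)_A}{(q^k;q^k)_B(q^k;q^k)_{A-B}}$ if $A\geq B\geq 0$, and $0$ otherwise. *)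

(* Defs.v *)
From HB Require Import structures.
From mathcomp Require Import all_boot all_order all_algebra finmap complex.
From mathcomp Require Import boolp classical_sets functions cardinality fsbigop.
From mathcomp Require Import reals topology normedtype.
From mathcomp.analysis.showcase Require Import summability.

Set Implicit Arguments.
Unset Strict Implicit.
Unset Printing Implicit Defensive.

Import Order.TTheory GRing.Theory Num.Theory.
Import numFieldNormedType.Exports.

Local Open Scope classical_set_scope.
Local Open Scope ring_scope.
Local Open Scope complex_scope.

(* Unconditional convergence: the partial sums over finite subsets of A,
   directed by inclusion, tend to l.  The regular algebra R[i]^o carries the
   topology of the complex modulus. *)
Definition has_sum (R : realType) (T : choiceType) (A : set T)
    (f : T -> R[i]) (l : R[i]) : Prop :=
  partial_sum (fun x => (if x \in A then f x else 0) : R[i]^o) @ totally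
    --> (l : R[i]^o).

Definition is_partition (p : seq nat) : bool :=
  sorted geq p && all (fun x => 0 < x)%N p.

Definition npartsmod (k d : nat) (p : seq nat) : nat :=
  count (fun x => x == d %[mod k])%N p.

(* Partitions into parts congruent to a or b mod k, without r + 1 consecutive
   parts all congruent to c mod k. *)
Definition restricted_partitions (a b k r c : nat) : set (seq nat) :=
  [set p | [/\ is_partition p,
     forall x, x \in p -> (x = a %[mod k] \/ x = b %[mod k])%N &
     ~ exists i, (i + r < size p)%N /\
         forall j, (j <= r)%N -> (nth 0 p (i + j) = c %[mod k])%N]].

Definition Pset (a b k r : nat) := restricted_partitions a b k r b.

Definition Pset' (a b k r : nat) := restricted_partitions a b k r a.

Definition weight (R : realType) (mu nu q : R[i]) (a b k : nat) (p : seq nat)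
    : R[i] :=
  mu ^+ npartsmod k a p * nu ^+ npartsmod k b p * q ^+ sumn p.

Definition qpoch (R : realType) (x q : R[i]) (n : nat) : R[i] :=
  \prod_(j < n) (1 - x * q ^+ j).

(* A and B are integers: the top entry may be negative, and the value is then
   0; truncated natural subtraction would give wrong values. *)
Definition qbinom (R : realType) (q : R[i]) (k : nat) (A B : int) : R[i] :=
  if (0 <= B) && (B <= A) then
    qpoch (q ^+ k) (q ^+ k) `|A|%N
    / (qpoch (q ^+ k) (q ^+ k) `|B|%N * qpoch (q ^+ k) (q ^+ k) `|A - B|%N)
  else 0.

(* In the sums below, \sum_(x \in D) is the finitely supported sum: only
   finitely many terms are nonzero, as the q-binomials vanish otherwise. *)
Definition alt_sum (R : realType) (q : R[i]) (k r s h : nat) : R[i] :=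
  \sum_(i \in [set: nat])
    ((-1) ^+ i * q ^+ ((r * k * (i ^ 2 - i)) %/ 2)%N
     * qbinom q (r * k) s%:Z i%:Z
     * qbinom q k (h%:Z - r%:Z * i%:Z + s%:Z - 1) (s%:Z - 1)).

(* Negative exponents of mu, nu or q occur only in terms with a vanishing
   q-binomial; x ^ n is 0 for x = 0 and n < 0. *)
Definition rhs_term (R : realType) (mu nu q : R[i]) (a b k r m : nat) : R[i] :=
  (qpoch (q ^+ k) (q ^+ k) m)^-1 *
  (mu ^+ m * q ^+ (m * a)%N +
   \sum_(s \in [set s : nat | (1 <= s)%N]) \sum_(h \in [set: nat])
     (mu ^ (m%:Z - h%:Z - s%:Z) * nu ^+ (h + s)%N
      * q ^ ((m%:Z - h%:Z - s%:Z) * a%:Z + (h%:Z + s%:Z) * b%:Z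
             + k%:Z * (s%:Z ^+ 2 - s%:Z))
      * qbinom q k (m%:Z - h%:Z - s%:Z + 1) s%:Z
      * alt_sum q k r s h)).

Definition rhs_term' (R : realType) (mu nu q : R[i]) (a b k r m : nat) : R[i] :=
  (qpoch (q ^+ k) (q ^+ k) m)^-1 *
  (nu ^+ m * q ^+ (m * b)%N +
   \sum_(s \in [set s : nat | (1 <= s)%N]) \sum_(h \in [set: nat])
     (mu ^+ (h + s)%N * nu ^ (m%:Z - h%:Z - s%:Z)
      * q ^ ((h%:Z + s%:Z) * a%:Z + (m%:Z - h%:Z - s%:Z) * b%:Z
             + k%:Z * (s%:Z - 1) ^+ 2)
      * (qbinom q k (m%:Z - h%:Z - s%:Z) (s%:Z - 1)
         + q ^ (k%:Z * (h%:Z + 2 * s%:Z - 1))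
           * qbinom q k (m%:Z - h%:Z - s%:Z) s%:Z)
      * alt_sum q k r s h)).

(* Main.v *)
Require Import Defs.
From mathcomp Require Import all_boot all_order all_algebra finmap complex.
From mathcomp Require Import classical_sets functions fsbigop.
From mathcomp Require Import reals topology normedtype sequences exp.
From mathcomp.analysis.showcase Require Import summability.
From mathcomp Require Import zify ring lra.

(* Let Q = q ^ k.  A partition with m parts is recorded as a word of residues
   in {a, b} together with the quotients of its parts by k.  Removing k from
   every part shows that the partitions with a given word contribute
   mu ^ #a * nu ^ #b * q ^ (a #a + b #b) * Q ^ maj / (Q; Q)_m, where maj is the
   sum of the positions at which a part congruent to a precedes a part congruent
   to b.  The words are then summed letter by letter, classified by the number s
   of runs of the restricted letter and by the excess h of that letter over s:
   the positions of the runs produce one Gaussian binomial, and their lengths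
   produce the coefficient of z ^ h in the product over j < s of
   (1 - (z Q ^ j) ^ r) / (1 - z Q ^ j), which the q-binomial theorem expands as
   the alternating sum.  Absolute convergence follows by encoding a partition
   through its multiplicities, because every value in the restricted class
   occurs at most r times. *)

Set Implicit Arguments.
Unset Strict Implicit.
Unset Printing Implicit Defensive.

Import Order.TTheory GRing.Theory Num.Theory.
Import numFieldNormedType.Exports.
Import ComplexField.Normc.

Local Open Scope classical_set_scope.
Local Open Scope ring_scope.
Local Open Scope complex_scope.

(** * Unconditional sums *)

Lemma ler_sum_subset (K : numDomainType) (I : eqType) (s s' : seq I)
    (f : I -> K) :
  (forall x, 0 <= f x) -> uniq s -> {subset s <= s'} ->
  \sum_(x <- s) f x <= \sum_(x <- s') f x.
Proof.
move=> f0; elim: s s' => [|x s IH] s' /= => [_ _|/andP[xs us] sub].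
  by rewrite big_nil sumr_ge0.
have xs' : x \in s' by apply: sub; rewrite mem_head.
rewrite big_cons (big_rem _ xs') /= lerD2l IH // => y ys.
have yx : y != x by apply: contraNneq xs => <-.
have := sub y; rewrite inE ys orbT => /(_ isT).
by rewrite (perm_mem (perm_to_rem xs')) inE (negPf yx).
Qed.

Section HasSum.
Variable R : realType.
Local Notation C := R[i].

Lemma norm_normc (z : C) : `|z| = (normc z)%:C.
Proof. by []. Qed.

Lemma normc_ge0 (z : C) : 0 <= normc z.
Proof. by case: z => x y; rewrite sqrtr_ge0. Qed.

Lemma normcX (z : C) n : normc (z ^+ n) = normc z ^+ n.
Proof.
by elim: n => [|n IH]; rewrite ?expr0 ?normc1 // !exprS normcM IH.
Qed.

Lemma normc_real (x : R) : normc x%:C = `|x|.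
Proof. by rewrite /normc /= expr0n /= addr0 sqrtr_sqr. Qed.

Lemma Re_le_normc (z : C) : `|complex.Re z| <= normc z.
Proof. by have := normc_ge_Re z; rewrite norm_normc lecR. Qed.

Lemma Im_le_normc (z : C) : `|complex.Im z| <= normc z.
Proof.
case: z => x y /=; rewrite -sqrtr_sqr ler_wsqrtr // lerDr sqr_ge0 //.
Qed.

Lemma ler_normcD (x y : C) : normc (x + y) <= normc x + normc y.
Proof. by rewrite -lecR rmorphD /= -!norm_normc ler_normD. Qed.

Lemma normc_lt_split (x y z : C) (e : R) :
  normc (x - y) < e / 2 -> normc (y - z) < e / 2 -> normc (x - z) < e.
Proof.
move=> h1 h2; have -> : x - z = (x - y) + (y - z) by rewrite addrA subrK.
by rewrite [e]splitr (le_lt_trans (ler_normcD _ _)) // ltrD.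
Qed.

Lemma normcB (x y : C) : normc (x - y) = normc (y - x).
Proof. by apply: complexI; rewrite -!norm_normc distrC. Qed.

Lemma partial_sumE (T : choiceType) (A : set T) (f : T -> C) (F : {fset T}) :
  partial_sum (fun x => (if x \in A then f x else 0) : C^o) F
    = \sum_(x <- F | x \in A) f x.
Proof. by rewrite /partial_sum (big_seq_fsetE +%R) /= -big_mkcond. Qed.

Lemma has_sumP (T : choiceType) (A : set T) (f : T -> C) (l : C) :
  has_sum A f l <-> forall e : R, 0 < e -> exists F0 : {fset T},
    forall F : {fset T}, (F0 `<=` F)%fset ->
      normc (\sum_(x <- F | x \in A) f x - l) < e.
Proof.
have FF := @totally_filter T; split.
- move=> /cvgrPdist_lt /= H e e0.
  have /H : 0 < e%:C :> C by rewrite ltcR.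
  case=> F0 _ HF; exists F0 => F /HF /=.
  by rewrite partial_sumE distrC norm_normc ltcR.
- move=> H; apply/cvgrPdist_lt => /= e; rewrite ltcE => /andP[/eqP eI e0].
  have [F0 HF] := H _ e0; exists F0 => // F /HF; rewrite partial_sumE.
  (* Positivity in [R[i]] includes a vanishing imaginary part, so [e] is a real radius. *)
  have -> : e = (complex.Re e)%:C by move: eI; case: (e) => u v /= ->.
  by rewrite distrC norm_normc ltcR.
Qed.

Lemma has_sum_unique (T : choiceType) (A : set T) (f : T -> C) (l l' : C) :
  has_sum A f l -> has_sum A f l' -> l = l'.
Proof.
move=> /has_sumP H /has_sumP H'; apply/eqP/negPn/negP => ne.
have d0 : 0 < normc (l - l').
  rewrite lt_neqAle normc_ge0 andbT eq_sym; apply/eqP => /eq0_normc /eqP.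
  by rewrite subr_eq0 (negPf ne).
have d2 : 0 < normc (l - l') / 2 by rewrite divr_gt0.
have [F0 HF] := H _ d2; have [F1 HF'] := H' _ d2.
have := HF (F0 `|` F1)%fset (fsubsetUl _ _).
have := HF' (F0 `|` F1)%fset (fsubsetUr _ _).
move=> h2; rewrite [ltLHS]normcB => h1.
by have := normc_lt_split h1 h2; rewrite ltxx.
Qed.

Lemma eq_has_sum (T : choiceType) (A : set T) (f g : T -> C) (l : C) :
  (forall x, A x -> f x = g x) -> has_sum A f l -> has_sum A g l.
Proof.
move=> fg /has_sumP H; apply/has_sumP => e /H[F0 HF]; exists F0 => F /HF.
by under eq_bigr => x /set_mem /fg -> do over.
Qed.

Lemma has_sumD (T : choiceType) (A : set T) (f g : T -> C) (l l' : C) :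
  has_sum A f l -> has_sum A g l' -> has_sum A (fun x => f x + g x) (l + l').
Proof.
move=> /has_sumP H /has_sumP H'; apply/has_sumP => e e0.
have d2 : 0 < e / 2 by rewrite divr_gt0.
have [F0 HF] := H _ d2; have [F1 HF'] := H' _ d2.
exists (F0 `|` F1)%fset => F; rewrite fsubUset => /andP[/HF h1 /HF' h2].
rewrite big_split /= opprD addrACA.
by rewrite [e]splitr (le_lt_trans (ler_normcD _ _)) // ltrD.
Qed.

Lemma has_sumZ (T : choiceType) (A : set T) (f : T -> C) (l c : C) :
  has_sum A f l -> has_sum A (fun x => c * f x) (c * l).
Proof.
move=> /has_sumP H; apply/has_sumP => e e0.
have c0 : 0 < normc c + 1 by rewrite ltr_wpDl ?normc_ge0.
have [F0 HF] := H _ (divr_gt0 e0 c0).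
exists F0 => F /HF h1; rewrite -big_distrr -mulrBr /= normcM.
have h : normc c <= normc c + 1 by rewrite lerDl.
apply: le_lt_trans (ler_wpM2r (normc_ge0 _) h) _.
by rewrite mulrC -ltr_pdivlMr.
Qed.

Arguments has_sumZ {T A f l} c _.

Lemma has_sum_mkcond (T : choiceType) (A B : set T) (f : T -> C) (l : C) :
  A `<=` B -> has_sum A f l <-> has_sum B (fun x => if x \in A then f x else 0) l.
Proof.
move=> AB; have E (F : {fset T}) : \sum_(x <- F | x \in A) f x
    = \sum_(x <- F | x \in B) (if x \in A then f x else 0).
  rewrite big_mkcond [RHS]big_mkcond; apply: eq_bigr => x _.
  case: ifPn => [xA|_]; last by rewrite if_same.
  by rewrite (mem_set (AB _ (set_mem xA))).
by split=> /has_sumP H; apply/has_sumP => e /H[F0 HF]; exists F0 => F /HF; rewrite E.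
Qed.

Lemma has_sum0 (T : choiceType) (f : T -> C) : has_sum set0 f 0.
Proof.
apply/has_sumP => e e0; exists fset0 => F _.
by rewrite big_pred0 ?subrr ?normc0 // => x; rewrite in_set0.
Qed.

Lemma has_sum1 (T : choiceType) (f : T -> C) x0 : has_sum [set x0] f (f x0).
Proof.
apply/has_sumP => e e0; exists [fset x0]%fset => F; rewrite fsub1set => xF.
rewrite (eq_bigl (pred1 x0)); last first.
  by move=> x; apply/idP/eqP => [/set_mem|->] //; apply: mem_set.
by rewrite -big_filter filter_pred1_uniq ?fset_uniq // big_seq1 subrr normc0.
Qed.

Lemma has_sumU (T : choiceType) (A B : set T) (f : T -> C) (l l' : C) :
  A `&` B `<=` set0 -> has_sum A f l -> has_sum B f l' ->
  has_sum (A `|` B) f (l + l').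
Proof.
move=> AB HA HB.
have HA' := (has_sum_mkcond f l (@subsetUl _ A B)).1 HA.
have HB' := (has_sum_mkcond f l' (@subsetUr _ A B)).1 HB.
apply: eq_has_sum (has_sumD HA' HB') => x [xA|xB].
  rewrite mem_set // memNset ?addr0 // => xB; exact: (AB x).
by rewrite [x \in B]mem_set // memNset ?add0r // => xA; exact: (AB x).
Qed.

(** The left inverse [psi] pulls a finite set back to a finite set: every point of [F] in the image
    of [A] is [phi x] for a unique [x] in [G], and the other points of [F] do not contribute. *)
Lemma has_sum_reindex (T U : choiceType) (phi : T -> U) (psi : U -> T)
    (A : set T) (f : U -> C) (l : C) :
  cancel phi psi -> has_sum A (fun x => f (phi x)) l ->
  has_sum (phi @` A) f l.
Proof.
move=> K /has_sumP H; apply/has_sumP => e /H[F0 HF].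
exists (phi @` F0)%fset => F sF.
pose G := [fset x in psi @` F | phi x \in F]%fset.
have -> : \sum_(y <- F | y \in phi @` A) f y = \sum_(x <- G | x \in A) f (phi x).
  rewrite -big_filter -[RHS]big_filter -(big_map phi xpredT) /=.
  apply: perm_big; apply: uniq_perm; rewrite ?filter_uniq ?fset_uniq //.
    by rewrite map_inj_uniq ?filter_uniq ?fset_uniq //; exact: can_inj K.
  move=> y; rewrite mem_filter; apply/andP/mapP.
  - case=> /set_mem [x Ax <-] yF; exists x => //; rewrite mem_filter mem_set //=.
    rewrite !inE yF andbT /=; apply/imfsetP; exists (phi x) => //; by rewrite K.
  - case=> x; rewrite mem_filter => /andP[/set_mem Ax]; rewrite !inE /=.
    by move=> /andP[_ xF] ->; split=> //; exists x.
apply: HF; apply/fsubsetP => x xF0; rewrite !inE /=.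
have pF : phi x \in F by apply: (fsubsetP sF); apply/imfsetP; exists x.
by rewrite pF andbT; apply/imfsetP; exists (phi x); rewrite ?K.
Qed.

Lemma has_sum_fibres (T : choiceType) (W : eqType) (A : set T) (g : T -> W)
    (f : T -> C) (t : W -> C) (s : seq W) :
  uniq s -> (forall w, w \in s -> has_sum [set x | A x /\ g x = w] f (t w)) ->
  has_sum [set x | A x /\ g x \in s] f (\sum_(w <- s) t w).
Proof.
elim: s => [_ _|w s IH /= /andP[ws us] H].
  rewrite big_nil (_ : [set _ | _] = set0); first exact: has_sum0.
  by apply/seteqP; split => x //= [].
rewrite big_cons.
rewrite (_ : [set x | _] = [set x | A x /\ g x = w] `|` [set x | A x /\ g x \in s]).
  apply: has_sumU; first by move=> x /= [[_ ->] [_ /(negP ws)]].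
    by apply: H; rewrite mem_head.
  by apply: IH => // v vs; apply: H; rewrite in_cons vs orbT.
apply/seteqP; split => x /=.
  by rewrite inE => -[Ax /orP[/eqP|]]; [left|right].
by rewrite inE => -[[Ax ->]|[Ax ->]]; rewrite ?eqxx ?orbT.
Qed.

(** Summation by blocks. Existence of the total sum is assumed because convergence of each block
    does not make the whole family summable. *)
Lemma has_sum_fibration (T : choiceType) (A : set T) (g : T -> nat)
    (f : T -> C) (t : nat -> C) (l : C) :
  has_sum A f l ->
  (forall n, has_sum [set x | A x /\ g x = n] f (t n)) -> has_sum setT t l.
Proof.
move=> /has_sumP H Ht; apply/has_sumP => e e0.
have d2 : 0 < e / 2 by rewrite divr_gt0.
have [F0 HF] := H _ d2.
exists (g @` F0)%fset => G sG.
under eq_bigl => x do rewrite in_setT.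
have HG : has_sum [set x | A x /\ g x \in (G : seq nat)] f (\sum_(w <- G) t w).
  apply: has_sum_fibres => [|n _]; [exact: fset_uniq|exact: Ht].
move/has_sumP: HG => /(_ _ d2)[F1 HF1].
(* [F0] controls the distance to [l], and [F1] the distance to the block sums over [G]. As [G]
   contains the values of [g] on [F0], the sum over [F] equals the sum over [F1] and [F0] together
   restricted to the blocks in [G], so both estimates apply to it. *)
pose F := ([fset x in F1 | g x \in G] `|` F0)%fset.
have h1 := HF F (fsubsetUr _ _).
have h2 := HF1 (F1 `|` F0)%fset (fsubsetUl _ _).
have E : \sum_(x <- F | x \in A) f x
   = \sum_(x <- (F1 `|` F0)%fset | x \in [set x | A x /\ g x \in (G : seq nat)]) f x.
  rewrite -big_filter -[RHS]big_filter; apply: perm_big.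
  apply: uniq_perm; rewrite ?filter_uniq ?fset_uniq // => x.
  rewrite !mem_filter !inE /=; apply/andP/andP.
  - case=> /set_mem Ax /orP[/andP[xF xG]|xF].
      by split; [apply: mem_set|rewrite xF].
    split; [apply: mem_set|by rewrite xF orbT]; split => //.
    by apply: (fsubsetP sG); apply/imfsetP; exists x.
  - by case=> /set_mem [Ax xG] xF; rewrite xG andbT; split => //; apply: mem_set.
move: h2; rewrite -E [ltLHS]normcB => h2.
exact: normc_lt_split h2 h1.
Qed.

Lemma has_sum_nonneg (T : choiceType) (A : set T) (f : T -> R) (M : R) :
  (forall x, 0 <= f x) ->
  (forall F : {fset T}, \sum_(x <- F | x \in A) f x <= M) ->
  exists l : C, has_sum A (fun x => (f x)%:C) l.
Proof.
move=> f0 HM.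
pose E := [set y | exists F : {fset T}, y = \sum_(x <- F | x \in A) f x].
have sE : has_sup E.
  by split; [exists (\sum_(x <- fset0 | x \in A) f x), fset0|exists M => y [F ->]].
(* The finite sums increase with the index set, so they converge to their supremum. *)
exists (sup E)%:C; apply/has_sumP => e e0.
have [_ [F0 ->] hF0] := sup_adherent e0 sE.
exists F0 => F sF; rewrite -[\sum_(_ <- _ | _) _]rmorph_sum -rmorphB normc_real.
have h1 : \sum_(x <- F | x \in A) f x <= sup E.
  by apply: sup_upper_bound => //; exists F.
have h2 : \sum_(x <- F0 | x \in A) f x <= \sum_(x <- F | x \in A) f x.
  rewrite -big_filter -[leRHS]big_filter ler_sum_subset ?filter_uniq ?fset_uniq //.
  by move=> x; rewrite !mem_filter => /andP[-> /(fsubsetP sF) ->].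
by rewrite ler0_norm; lra.
Qed.

(** Writes [f] as the difference of the nonnegative families [|f| + f] and [|f|], whose finite sums
    are bounded. *)
Lemma has_sum_real (T : choiceType) (A : set T) (f : T -> R) (M : R) :
  (forall F : {fset T}, \sum_(x <- F | x \in A) `|f x| <= M) ->
  exists l : C, has_sum A (fun x => (f x)%:C) l.
Proof.
move=> HM.
have [l1 H1] : exists l : C, has_sum A (fun x => (`|f x| + f x)%:C) l.
  apply: (@has_sum_nonneg _ _ _ (M *+ 2)) => [x|F].
    by have := ler_norm (- f x); rewrite normrN; lra.
  apply: le_trans (ler_wMn2r 2 (HM F)); rewrite -sumrMnl.
  by apply: ler_sum => x _; rewrite mulr2n lerD2l ler_norm.
have [l2 H2] : exists l : C, has_sum A (fun x => (`|f x|)%:C) l.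
  by apply: (@has_sum_nonneg _ _ _ M).
eexists; apply: eq_has_sum (has_sumD H1 (has_sumZ (-1) H2)) => x _.
by rewrite mulN1r -rmorphN -rmorphD; congr (_%:C); lra.
Qed.

Lemma abs_summable (T : choiceType) (A : set T) (f : T -> C) (M : R) :
  (forall F : {fset T}, \sum_(x <- F | x \in A) normc (f x) <= M) ->
  exists l : C, has_sum A f l.
Proof.
move=> HM.
have [l1 H1] : exists l : C, has_sum A (fun x => (complex.Re (f x))%:C) l.
  apply: (@has_sum_real _ _ _ M) => F; apply: le_trans (HM F).
  by apply: ler_sum => x _; exact: Re_le_normc.
have [l2 H2] : exists l : C, has_sum A (fun x => (complex.Im (f x))%:C) l.
  apply: (@has_sum_real _ _ _ M) => F; apply: le_trans (HM F).
  by apply: ler_sum => x _; exact: Im_le_normc.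
eexists; apply: eq_has_sum (has_sumD H1 (has_sumZ 'i%C H2)) => x _.
by rewrite -complexE.
Qed.

End HasSum.
Arguments has_sumZ {R T A f l} c _.

(** * Gaussian binomials and the alternating sum *)

Section QBinomial.
Variables (R : realType) (Q : R[i]).
Local Notation C := R[i].

(** Gaussian binomial with natural entries and base [Q], suited to induction; [qbinom_nat] connects
    it with [qbinom]. *)
Definition gbin (n j : nat) : C :=
  if (j <= n)%N then qpoch Q Q n / (qpoch Q Q j * qpoch Q Q (n - j)) else 0.

Hypothesis Q_neq1 : forall n, Q ^+ n.+1 != 1.

Lemma qpochS n : qpoch Q Q n.+1 = qpoch Q Q n * (1 - Q ^+ n.+1).
Proof. by rewrite /qpoch big_ord_recr /= exprS. Qed.

Lemma subXn_neq0 n : 1 - Q ^+ n.+1 != 0.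
Proof. by rewrite subr_eq0 eq_sym. Qed.

Lemma qpoch_neq0 n : qpoch Q Q n != 0.
Proof.
elim: n => [|n IH]; first by rewrite /qpoch big_ord0 oner_neq0.
by rewrite qpochS mulf_neq0 ?subXn_neq0.
Qed.

Lemma gbin0 n : gbin n 0 = 1.
Proof. by rewrite /gbin subn0 /qpoch big_ord0 mul1r divff // qpoch_neq0. Qed.

Lemma gbinn n : gbin n n = 1.
Proof. by rewrite /gbin leqnn subnn /qpoch big_ord0 mulr1 divff // qpoch_neq0. Qed.

Lemma gbin_small n j : (n < j)%N -> gbin n j = 0.
Proof. by rewrite /gbin ltnNge => /negPf ->. Qed.

(** Of the two q-Pascal rules, this one serves [hcoef] and the placement of runs in words;
    [gbin_rec'] serves [ecoef]. *)
Lemma gbin_rec n j : gbin n.+1 j.+1 = gbin n j.+1 + Q ^+ (n - j) * gbin n j.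
Proof.
case: (ltngtP j n) => [jn|nj|->]; last first.
- by rewrite !gbinn (@gbin_small n n.+1) // subnn expr0 add0r mulr1.
- by rewrite !gbin_small ?mulr0 ?addr0 // ltnS ltnW.
rewrite /gbin ltnS (ltnW jn) jn subSS.
have -> : (n - j = (n - j.+1).+1)%N by lia.
set d := (n - j.+1)%N; have -> : n = (j + d.+1)%N by rewrite /d; lia.
rewrite !qpochS -addSn exprD.
have h1 := subXn_neq0 j; have h2 := subXn_neq0 d.
have h3 := qpoch_neq0 j; have h4 := qpoch_neq0 d.
by field; rewrite h1 h2 h3 h4.
Qed.

Lemma gbin_rec' n j : gbin n.+1 j.+1 = gbin n j + Q ^+ j.+1 * gbin n j.+1.
Proof.
case: (ltngtP j n) => [jn|nj|->]; last first.
- by rewrite !gbinn (@gbin_small n n.+1) // mulr0 addr0.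
- by rewrite !gbin_small ?mulr0 ?addr0 // ltnS ltnW.
rewrite /gbin ltnS (ltnW jn) jn subSS.
have -> : (n - j = (n - j.+1).+1)%N by lia.
set d := (n - j.+1)%N; have -> : n = (j + d.+1)%N by rewrite /d; lia.
rewrite !qpochS -addSn exprD.
have h1 := subXn_neq0 j; have h2 := subXn_neq0 d.
have h3 := qpoch_neq0 j; have h4 := qpoch_neq0 d.
by field; rewrite h1 h2 h3 h4.
Qed.

End QBinomial.

(** Sliding a window of length [n] by one step changes its sum only by the entering and the leaving
    term. *)
Lemma sum_window_rec (V : zmodType) (f : nat -> V) n h : (0 < n)%N ->
  \sum_(x < n | (x <= h.+1)%N) f (h.+1 - x)%N
    - \sum_(x < n | (x <= h)%N) f (h - x)%N
  = f h.+1 - (if (n <= h.+1)%N then f (h.+1 - n)%N else 0).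
Proof.
case: n => // n _; rewrite big_mkcond big_ord_recl /= subn0.
rewrite [X in _ - X]big_mkcond big_ord_recr /= subSS ltnS.
under eq_bigr => i _ do rewrite /bump /= add1n subSS ltnS.
by rewrite opprD addrA addrK.
Qed.

Section AltSum.
Variables (R : realType) (Q : R[i]) (r : nat).
Hypothesis Q_neq1 : forall n, Q ^+ n.+1 != 1.
Hypothesis r_gt0 : (0 < r)%N.
Local Notation C := R[i].

(* Coefficient of z ^ h in the product over j < s of
   1 + z Q ^ j + ... + (z Q ^ j) ^ (r - 1). *)
Fixpoint run_coef (s h : nat) : C :=
  if s is s'.+1 then
    \sum_(x < r | (x <= h)%N) Q ^+ (h - x) * run_coef s' (h - x)
  else (h == 0)%:R.

(** With F_s(z) the generating function of [run_coef s], this is the coefficient form of (1 - z)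
    F_{s+1}(z) = (1 - z^r) F_s(zQ). *)
Lemma run_coef_rec s h :
  run_coef s.+1 h.+1 - run_coef s.+1 h = Q ^+ h.+1 * run_coef s h.+1
  - (if (r <= h.+1)%N then Q ^+ (h.+1 - r) * run_coef s (h.+1 - r) else 0).
Proof. exact: (sum_window_rec (fun y => Q ^+ y * run_coef s y)). Qed.

(* Coefficient of z ^ n in 1 / (z; Q)_s. *)
Definition hcoef (s n : nat) : C :=
  if s is s'.+1 then gbin Q (n + s') s' else (n == 0)%:R.

(* Coefficient of z ^ i in (z; Q ^ r)_s. *)
Definition ecoef (s i : nat) : C :=
  (-1) ^+ i * (Q ^+ r) ^+ 'C(i, 2) * gbin (Q ^+ r) s i.

Lemma Qr_neq1 n : (Q ^+ r) ^+ n.+1 != 1.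
Proof. by rewrite -exprM -(prednK r_gt0) mulnC mulnS addSn. Qed.

Lemma hcoef0 s : hcoef s 0 = 1.
Proof. by case: s => [|s] //=; rewrite add0n gbinn. Qed.

(** Coefficient form of (1 - z) / (z; Q)_{s+1} = 1 / (zQ; Q)_s. *)
Lemma hcoef_rec s n :
  hcoef s.+1 n.+1 - hcoef s.+1 n = Q ^+ n.+1 * hcoef s n.+1.
Proof.
case: s => [|s] /=; first by rewrite !gbin0 // subrr mulr0.
rewrite addSn gbin_rec // addSnnS (_ : (n + s.+1 - s = n.+1)%N); last by lia.
by rewrite addrC addKr.
Qed.

Lemma ecoef0 s : ecoef s 0 = 1.
Proof. by rewrite /ecoef gbin0 ?mulr1 //; exact: Qr_neq1. Qed.

(** Coefficient form of (z; Q^r)_{s+1} = (1 - z) (z Q^r; Q^r)_s. *)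
Lemma ecoef_rec s i :
  ecoef s.+1 i.+1 = Q ^+ (r * i.+1) * ecoef s i.+1 - Q ^+ (r * i) * ecoef s i.
Proof.
rewrite /ecoef gbin_rec'; last exact: Qr_neq1.
rewrite !exprM binS bin1 addnC exprD exprS; ring.
Qed.

(** Coefficient of z^h in z^d / (z; Q)_s; the test guards against truncated subtraction. *)
Definition hcoef_sub (s h d : nat) : C :=
  if (d <= h)%N then hcoef s (h - d) else 0.

(** Coefficient of z^h in (z^r; Q^r)_s / (z; Q)_s, with the numerator cut to its first [L] terms. *)
Definition alt_coef (L s h : nat) : C :=
  \sum_(i < L) ecoef s i * hcoef_sub s h (r * i).

Lemma hcoef_sub_rec s h d :
  hcoef_sub s.+1 h.+1 d - hcoef_sub s.+1 h d = Q ^+ (h.+1 - d) * hcoef_sub s h.+1 d.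
Proof.
rewrite /hcoef_sub; case: (ltngtP d h.+1) => [|dh|->]; rewrite ?ltnS.
- by move=> dh; rewrite dh subSn // hcoef_rec.
- by rewrite leqNgt (ltn_trans (ltnSn h) dh) /= subrr mulr0.
- by rewrite ltnn subnn !hcoef0 subr0 mulr1.
Qed.

(** The recurrence of [run_coef_rec] for the truncated series. In the last term the numerator index
    drops by one, since [ecoef_rec] links [i.+1] to [i]; hence the bound [L] there and [L.+1]
    elsewhere. *)
Lemma alt_coef_rec L s h :
  alt_coef L.+1 s.+1 h.+1 - alt_coef L.+1 s.+1 h
  = Q ^+ h.+1 * alt_coef L.+1 s h.+1
  - (if (r <= h.+1)%N then Q ^+ (h.+1 - r) * alt_coef L s (h.+1 - r) else 0).
Proof.
rewrite /alt_coef -sumrB.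
under eq_bigr => i _ do rewrite -mulrBr hcoef_sub_rec.
rewrite big_ord_recl [in RHS]big_ord_recl /= muln0 !ecoef0 subn0 !mul1r mulrDr -addrA.
congr (_ + _).
have -> : (if (r <= h.+1)%N
   then Q ^+ (h.+1 - r) *
     (\sum_(i < L) ecoef s i * hcoef_sub s (h.+1 - r) (r * i)) else 0)
  = \sum_(i < L) (if (r <= h.+1)%N then
       Q ^+ (h.+1 - r) * (ecoef s i * hcoef_sub s (h.+1 - r) (r * i)) else 0).
  by case: ifP => _; [rewrite big_distrr|rewrite big1].
rewrite big_distrr -sumrB; apply: eq_bigr => i _ /=.
rewrite /bump /= add1n ecoef_rec /hcoef_sub.
have -> : (r * i.+1 <= h.+1)%N = (r <= h.+1)%N && (r * i <= h.+1 - r)%N.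
  rewrite mulnS; case: (leqP r h.+1) => /= h1; first by rewrite leq_subRL.
  by apply/negbTE; rewrite -ltnNge; lia.
case: (leqP r h.+1) => /= h1; last by rewrite !mulr0 subr0.
case: (leqP (r * i)%N (h.+1 - r)%N) => /= h2; last by rewrite !mulr0 subr0.
have e1 : Q ^+ h.+1 = Q ^+ (r * i.+1) * Q ^+ (h.+1 - r * i.+1).
  by rewrite -exprD; congr (_ ^+ _); rewrite mulnS; lia.
have e2 : Q ^+ (h.+1 - r) = Q ^+ (r * i) * Q ^+ (h.+1 - r * i.+1).
  by rewrite -exprD; congr (_ ^+ _); rewrite mulnS; lia.
rewrite e1 e2 mulnS subnDA; ring.
Qed.

Lemma run_coef0 s : run_coef s 0 = 1.
Proof.
elim: s => //= s IH; rewrite (big_pred1 (Ordinal r_gt0)) /=.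
  by rewrite subn0 IH mulr1.
by move=> x; rewrite leqn0.
Qed.

Lemma alt_coef0 L s : alt_coef L.+1 s 0 = 1.
Proof.
rewrite /alt_coef big_ord_recl /= muln0 ecoef0 /hcoef_sub /= hcoef0 mulr1.
rewrite big1 ?addr0 // => i _; rewrite leqNgt muln_gt0 r_gt0 /= mulr0 //.
Qed.

(** Both sides obey the same recurrence and agree at [h = 0] and at [s = 0]. The condition [h < L]
    retains every [i] with [r * i <= h], and it survives the recurrence because [r] is positive. *)
Lemma alt_coefE L s h : (h < L)%N -> alt_coef L s h = run_coef s h.
Proof.
elim: s h L => [|s IHs] h [//|L].
  rewrite /alt_coef big_ord_recl muln0 ecoef0 /hcoef_sub /= subn0 mul1r => _.
  rewrite big1 ?addr0 // => i _.
  by rewrite /ecoef gbin_small // mulr0 mul0r.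
elim: h L => [|h IHh] L hL; first by rewrite alt_coef0 run_coef0.
have := alt_coef_rec L s h; have := run_coef_rec s h.
rewrite IHs // (IHh _ (ltnW hL)).
have -> : alt_coef L s (h.+1 - r) = run_coef s (h.+1 - r).
  by apply: IHs; rewrite ltnS in hL; move: hL; lia.
by move=> <- /(@subIr _ _ _ _).
Qed.

Lemma alt_coef_widen L s h : (s < L)%N -> alt_coef L s h = run_coef s h.
Proof.
move=> sL; rewrite -(@alt_coefE (maxn L h.+1)) ?leq_maxr //.
rewrite /alt_coef -!(big_mkord xpredT (fun i => ecoef s i * hcoef_sub s h (r * i))).
rewrite [RHS](big_cat_nat (leq0n _) (leq_maxl L h.+1)) /=.
rewrite [X in _ = _ + X]big_nat_cond [X in _ = _ + X]big1 ?addr0 // => i.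
by move=> /andP[/andP[Li _] _]; rewrite /ecoef gbin_small ?mulr0 ?mul0r // (leq_trans sL).
Qed.

End AltSum.

Lemma qbinom_nat (R : realType) (q : R[i]) (d n j : nat) :
  qbinom q d n%:Z j%:Z = gbin (q ^+ d) n j.
Proof.
rewrite /qbinom /gbin lez_nat /=; case: leqP => // jn.
by rewrite (_ : `|n%:Z - j%:Z|%N = (n - j)%N) //; lia.
Qed.

(** * Finitely supported sums and integer q-binomials in terms of natural indices *)

Section Bridge.
Variables (R : realType) (q : R[i]) (k : nat).
Hypothesis q_neq1 : forall n, q ^+ n.+1 != 1.
Hypothesis k_gt0 : (0 < k)%N.
Local Notation C := R[i].

Lemma qX_neq1 n : (q ^+ k) ^+ n.+1 != 1.
Proof. by rewrite -exprM -(prednK k_gt0) mulnC mulnS addSn. Qed.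

Lemma fsum_nat (f : nat -> C) n : (forall i, (n <= i)%N -> f i = 0) ->
  \sum_(i \in [set: nat]) f i = \sum_(i < n) f i.
Proof.
move=> f0; rewrite -(@fsbig_widen _ _ _ _ `I_n) ?fsbig_ord //.
by move=> i [_ /=] /negP; rewrite -leqNgt => /f0.
Qed.

Lemma fsum_pos (f : nat -> C) n : (forall i, (n < i)%N -> f i = 0) ->
  \sum_(i \in [set i : nat | (1 <= i)%N]) f i = \sum_(i < n) f i.+1.
Proof.
move=> f0; rewrite fsbig_mkcond (@fsum_nat _ n.+1) => [|i ni]; last first.
  by rewrite /patch; case: ifP => // _; exact: f0.
rewrite big_ord_recl {1}/patch memNset //= add0r; apply: eq_bigr => i _.
by rewrite /patch mem_set.
Qed.

(** The index is [s.+1] because for no run the lower entry [s - 1] is negative and [alt_sum] is 0,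
    whereas [run_coef] at [s = h = 0] is 1. *)
Lemma alt_sumE r s h : (0 < r)%N ->
  alt_sum q k r s.+1 h = run_coef (q ^+ k) r s.+1 h.
Proof.
move=> r0; rewrite /alt_sum (@fsum_nat _ s.+2) => [|i si].
  rewrite -(@alt_coef_widen _ _ _ qX_neq1 r0 s.+2) //; apply: eq_bigr => i _.
  rewrite qbinom_nat /ecoef -!exprM; congr (_ * _ * _ * _).
  - congr (_ ^+ _); rewrite bin2 -divn2 (_ : i ^ 2 - i = i * i.-1)%N.
      rewrite [RHS]mulnA [(k * r)%N]mulnC muln_divA // dvdn2 oddM.
      by case: (nat_of_ord i) => //= n; case: odd.
    by rewrite expnS expn1 -{3}[nat_of_ord i]muln1 -mulnBr subn1.
  - by rewrite mulnC.
  - rewrite /hcoef_sub; case: leqP => /= hi.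
      rewrite -qbinom_nat; congr qbinom; lia.
    (* For [h < r * i] the upper entry is below the lower one, matching the zero value of
       [hcoef_sub]. *)
    by rewrite /qbinom ifF //; apply/negbTE; lia.
by rewrite qbinom_nat gbin_small // mulr0 mul0r.
Qed.

End Bridge.

(** * Words with bounded runs *)

Lemma big_fibre (V : nmodType) (I : Type) (s : seq I) (P : pred I) (g : I -> nat)
    (n : nat) (F : I -> V) :
  (forall i, P i -> (g i < n)%N) ->
  \sum_(i <- s | P i) F i = \sum_(j < n) \sum_(i <- s | P i && (g i == j)) F i.
Proof.
move=> gn; rewrite [RHS](exchange_big_dep P) /=; last by move=> j i _ /andP[].
apply: eq_bigr => i Pi; rewrite (big_pred1 (Ordinal (gn i Pi))) // => j.
by rewrite Pi /= -val_eqE /= eq_sym.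
Qed.

(* A word lists letters from the smallest part of a partition upwards; true
   stands for the residue b and false for the residue a. *)
Fixpoint words (m : nat) : seq (seq bool) :=
  if m is m'.+1 then
    [seq true :: w | w <- words m'] ++ [seq false :: w | w <- words m']
  else [:: [::]].

Lemma mem_words m w : (w \in words m) = (size w == m).
Proof.
elim: m w => [|m IH] [|x w] //=.
- by rewrite mem_cat; apply/negbTE/norP; split; apply/mapP => -[].
- rewrite mem_cat eqSS -IH; apply/orP/idP => [[]/mapP[v vm [_ ->]]|wm] //.
  by case: x; [left|right]; apply/mapP; exists w.
Qed.

Lemma words_uniq m : uniq (words m).
Proof.
elim: m => //= m IH; rewrite cat_uniq !map_inj_uniq ?IH //=; try by move=> ? ? [].
by rewrite andbT; apply/hasPn => w /mapP[v _ ->]; apply/mapP => -[].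
Qed.

Lemma big_wordsS (V : nmodType) (c : bool) m (P : pred (seq bool))
    (F : seq bool -> V) :
  \sum_(w <- words m.+1 | P w) F w =
  \sum_(w <- words m | P (c :: w)) F (c :: w)
  + \sum_(w <- words m | P (~~ c :: w)) F (~~ c :: w).
Proof. by rewrite /= big_cat !big_map /=; case: c; rewrite //= addrC. Qed.

Section Words.
Variable c : bool.

Fixpoint lrun (w : seq bool) : nat :=
  if w is x :: w' then (if x == c then (lrun w').+1 else 0) else 0.

(** A run is counted at its last letter, the first one placed when a word is built by prepending;
    the other letters of the run go into [excess]. *)
Fixpoint nruns (w : seq bool) : nat :=
  if w is x :: w' then ((x == c) && (lrun w' == 0)) + nruns w' else 0.

Fixpoint excess (w : seq bool) : nat :=
  if w is x :: w' then ((x == c) && (lrun w' != 0)) + excess w' else 0.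

Fixpoint short_runs (r : nat) (w : seq bool) : bool :=
  if w is x :: w' then (lrun w <= r)%N && short_runs r w' else true.

Lemma count_runs w : count_mem c w = (nruns w + excess w)%N.
Proof. by elim: w => //= x w ->; case: (x == c); case: (lrun w == 0) => /=; lia. Qed.

Lemma short_runs_lrun r w : short_runs r w -> (lrun w <= r)%N.
Proof. by case: w => //= x w /andP[]. Qed.

Variables (K : fieldType) (alpha beta : nat -> K).

(* After m letters, starting a run weighs alpha m and closing one beta m. *)
Fixpoint wordq (w : seq bool) : K :=
  if w is x :: w' then
    (if x == c then (if lrun w' == 0 then alpha (size w') else 1)
     else (if lrun w' == 0 then 1 else beta (size w'))) * wordq w'
  else 1.

Variable r : nat.
Hypothesis r_gt0 : (0 < r)%N.

(** The length and the leading run [t] determine the weight of a prepended letter, so these sums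
    form a closed recursive system. *)
Definition state_sum (m s h t : nat) : K :=
  \sum_(w <- words m | [&& short_runs r w, nruns w == s, excess w == h & lrun w == t])
    wordq w.

(** Such a word starts with the unrestricted letter, which either follows a tail without leading run
    or closes a run of length 1 to [r]. *)
Lemma state_sumS0 m s h :
  state_sum m.+1 s h 0
  = state_sum m s h 0 + beta m * \sum_(t < r) state_sum m s h t.+1.
Proof.
rewrite /state_sum (big_wordsS c) /= !eqxx /=.
rewrite big_pred0 ?add0r => [|w]; last by rewrite !andbF.
have -> /= : (~~ c == c) = false by case: c.
rewrite (@big_fibre _ _ _ _ lrun r.+1) => [|w]; last first.
  by case/andP => /short_runs_lrun; rewrite ltnS.
rewrite big_ord_recl; congr (_ + _).
  apply: eq_big => w; first by rewrite !add0n -!andbA.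
  by case/andP=> _ /eqP ->; rewrite eqxx mul1r.
rewrite big_distrr; apply: eq_bigr => t _ /=; rewrite big_distrr.
rewrite big_seq_cond [RHS]big_seq_cond; apply: eq_big => w.
  by rewrite !add0n -!andbA.
by rewrite mem_words => /andP[/eqP -> /andP[_ /eqP ->]].
Qed.

(** A leading run of length 1 has just been opened, which pays [alpha]; [state_sumSS] lengthens an
    open run with factor 1 and raises the excess instead. *)
Lemma state_sumS1 m s h : state_sum m.+1 s.+1 h 1 = alpha m * state_sum m s h 0.
Proof.
rewrite /state_sum (big_wordsS c) /= eqxx /=.
have -> /= : (~~ c == c) = false by case: c.
rewrite [X in _ + X]big_pred0 ?addr0 => [|w]; last by rewrite !andbF.
rewrite big_distrr big_seq_cond [RHS]big_seq_cond; apply: eq_big => w.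
  rewrite eqSS; case: (lrun w =P 0) => [->|_]; last by rewrite !andbF.
  by rewrite r_gt0 add1n eqSS.
by rewrite mem_words eqSS => /andP[/eqP -> /and4P[_ _ _ /eqP ->]].
Qed.

Lemma state_sumS10 m h : state_sum m.+1 0 h 1 = 0.
Proof.
rewrite /state_sum big1 // => w /and4P[_]; case: w => //= x w.
by case: (x == c); case: (lrun w).
Qed.

Lemma state_sumSS m s h t :
  state_sum m.+1 s h.+1 t.+2 = if (t.+1 < r)%N then state_sum m s h t.+1 else 0.
Proof.
rewrite /state_sum (big_wordsS c) /= eqxx /=.
have -> /= : (~~ c == c) = false by case: c.
rewrite [X in _ + X]big_pred0 ?addr0 => [|w]; last by rewrite !andbF.
case: ifP => tr; last first.
  rewrite big_pred0 // => w; rewrite eqSS.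
  by case: (lrun w =P t.+1) => [->|_]; rewrite ?tr ?andbF.
apply: eq_big => w; rewrite eqSS; case: (lrun w =P t.+1) => [->|_]; rewrite ?andbF //.
  by rewrite tr add0n add1n eqSS.
by rewrite mul1r.
Qed.

Lemma state_sumSS0 m s t : state_sum m.+1 s 0 t.+2 = 0.
Proof.
rewrite /state_sum big1 // => w /and4P[_ _]; case: w => //= x w.
by case: (x == c); case: (lrun w).
Qed.

(* e N s h stands for the sum over the words with N unrestricted letters,
   s runs and excess h that do not end inside a run. *)
Variable e : nat -> nat -> nat -> K.
Hypothesis e0 : forall s h, e 0 s h = ((s == 0) && (h == 0))%:R.
Hypothesis eS0 : forall N h, e N.+1 0 h = e N 0 h.
Hypothesis eSS : forall N s h, e N.+1 s.+1 h = e N s.+1 h +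
  beta (N + s.+1 + h)%N *
    \sum_(t < r | (t <= h)%N) alpha (N + s + (h - t))%N * e N s (h - t)%N.

(** Stripping a leading run of length [t'.+1] leaves [N] unrestricted letters, [s'] runs and excess
    [h - t']. The length of this remainder is the argument of [alpha]. *)
Definition state_val N s h t : K :=
  match t, s with
  | 0, _ => e N s h
  | _.+1, 0 => 0
  | t'.+1, s'.+1 => if (t' < r)%N && (t' <= h)%N
                    then alpha (N + s' + (h - t'))%N * e N s' (h - t')%N else 0
  end.

Lemma state_sumE m s h t :
  state_sum m s h t = if (s + h <= m)%N then state_val (m - (s + h)) s h t else 0.
Proof.
elim: m s h t => [|m IH] s h t.
  rewrite /state_sum /= big_mkcond big_seq1 /=.
  case: s => [|s] //=; case: h => [|h] //=; case: t => [|t] //=.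
case: t => [|[|t]].
- rewrite state_sumS0 IH; under eq_bigr => t _ do rewrite IH.
  case: (ltngtP (s + h) m.+1) => [|sm|E]; rewrite ?ltnS.
  + move=> sm; rewrite sm subSn //; set N := (m - (s + h))%N.
    have -> : m = (N + s + h)%N by rewrite /N; lia.
    case: s sm @N => [|s] sm N /=; first by rewrite eS0 big1 ?mulr0 ?addr0.
    rewrite eSS; congr (_ + _ * _); rewrite [RHS]big_mkcond.
    by apply: eq_bigr => t _; rewrite ltn_ord.
  + by rewrite leqNgt (ltnW sm) /= add0r big1 ?mulr0.
  (* No unrestricted letter is left here, and [e 0 s h] vanishes because [s + h] is positive. *)
  + rewrite E ltnn subnn add0r big1 ?mulr0 //= e0.
    by case: s h E => [|s] [|h].
- case: s => [|s]; first by rewrite state_sumS10 if_same.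
  rewrite state_sumS1 IH addSn ltnS subSS /= r_gt0 /= subn0.
  by case: ifP => sm; rewrite ?mulr0 //; congr (alpha _ * _); lia.
- case: h => [|h].
    by rewrite state_sumSS0; case: s => [|s]; rewrite /= ?andbF ?if_same.
  rewrite state_sumSS IH addnS ltnS subSS.
  case: s => [|s] /=; first by rewrite !if_same.
  rewrite ltnS subSS; case: ifP => tr; last by rewrite /= if_same.
  by rewrite (ltnW tr).
Qed.

Lemma words_sumE m (G : nat -> nat -> K) :
  \sum_(w <- words m | short_runs r w) wordq w * G (nruns w) (excess w)
  = \sum_(s < m.+1) \sum_(h < m.+1)
      (\sum_(t < r.+1) state_sum m s h t) * G s h.
Proof.
rewrite big_seq_cond (@big_fibre _ _ _ _ nruns m.+1); last first.
  move=> w; rewrite mem_words => /andP[/eqP sw _].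
  by rewrite ltnS -sw (leq_trans _ (count_size (pred1 c) w)) // count_runs leq_addr.
apply: eq_bigr => s _; rewrite (@big_fibre _ _ _ _ excess m.+1); last first.
  move=> w; rewrite mem_words => /andP[/andP[/eqP sw _] _].
  by rewrite ltnS -sw (leq_trans _ (count_size (pred1 c) w)) // count_runs leq_addl.
apply: eq_bigr => h _; rewrite (@big_fibre _ _ _ _ lrun r.+1); last first.
  by move=> w /andP[/andP[/andP[_ /short_runs_lrun]]].
rewrite big_distrl; apply: eq_bigr => t _ /=.
rewrite /state_sum big_distrl [RHS]big_seq_cond /=; apply: eq_big => w.
  by rewrite -!andbA.
by move=> /andP[/andP[/andP[_ /eqP ->] /eqP ->] _].
Qed.

End Words.

(* The sum of the positions i at which a part congruent to a is followed by
   a smaller part congruent to b. *)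
Fixpoint maj (w : seq bool) : nat :=
  if w is x :: w' then
    ((if x && ~~ head true w' then size w' else 0) + maj w')%N else 0.

(** Each b directly before an a contributes to [maj]. If b is the restricted letter this happens
    where a run is opened, so [alpha] carries the power; in [wordq_maja] it happens where a run is
    closed, so [beta] does. An empty tail has size 0 and contributes 1. *)
Lemma wordq_majb (K : fieldType) (Q : K) w :
  wordq true (fun n => Q ^+ n) (fun=> 1) w = Q ^+ maj w.
Proof.
elim: w => //= x w ->; rewrite exprD; congr (_ * _).
by case: x; case: w => [|[] w].
Qed.

Lemma wordq_maja (K : fieldType) (Q : K) w :
  wordq false (fun=> 1) (fun n => Q ^+ n) w = Q ^+ maj w.
Proof.
elim: w => //= x w ->; rewrite exprD; congr (_ * _).
by case: x; case: w => [|[] w].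
Qed.

(** * Closed forms of the word sums *)

Section Totals.
Variables (R : realType) (Q : R[i]) (r : nat).
Hypothesis Q_neq1 : forall n, Q ^+ n.+1 != 1.
Hypothesis r_gt0 : (0 < r)%N.
Local Notation C := R[i].
Local Notation rc := (run_coef Q r).

Section General.
Variables (c : bool) (alpha beta : nat -> C) (e : nat -> nat -> nat -> C).
Hypothesis e0 : forall s h, e 0 s h = ((s == 0) && (h == 0))%:R.
Hypothesis eS0 : forall N h, e N.+1 0 h = e N 0 h.
Hypothesis eSS : forall N s h, e N.+1 s.+1 h = e N s.+1 h +
  beta (N + s.+1 + h)%N *
    \sum_(t < r | (t <= h)%N) alpha (N + s + (h - t))%N * e N s (h - t)%N.

(** Words without a run give [x ^+ m]. For the others the leading run is summed out: length 0 gives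
    the term in [e], positive lengths give the window sum. *)
Lemma words_total m (x y : C) :
  \sum_(w <- words m | short_runs c r w)
     wordq c alpha beta w * (x ^+ count_mem (~~ c) w * y ^+ count_mem c w)
  = x ^+ m + \sum_(s < m) \sum_(h < m.+1)
      if (s.+1 + h <= m)%N then
        (e (m - (s.+1 + h)) s.+1 h + \sum_(t < r | (t <= h)%N)
           alpha (m - (s.+1 + h) + s + (h - t))%N
           * e (m - (s.+1 + h)) s (h - t)%N)
        * (x ^+ (m - (s.+1 + h)) * y ^+ (s.+1 + h))
      else 0.
Proof.
pose G s h := x ^+ (m - (s + h)) * y ^+ (s + h).
transitivity (\sum_(w <- words m | short_runs c r w)
     wordq c alpha beta w * G (nruns c w) (excess c w)).
  rewrite big_seq_cond [RHS]big_seq_cond; apply: eq_bigr => w.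
  rewrite mem_words => /andP[/eqP sw _]; rewrite /G -count_runs.
  have -> // : count_mem (~~ c) w = (m - count_mem c w)%N.
  rewrite -sw -(count_predC (pred1 c) w) addKn; apply: eq_count => z /=.
  by case: c; case: z.
rewrite words_sumE big_ord_recl; congr (_ + _).
  rewrite big_ord_recl [X in _ + X]big1 ?addr0 => [|h _].
    rewrite /G big_ord_recl big1 ?addr0 => [|t _]; last first.
      by rewrite (state_sumE _ _ e0 eS0 eSS).
    rewrite (state_sumE _ _ e0 eS0 eSS) //= subn0 expr0 mulr1.
    suff -> : e m 0 0 = 1 by rewrite mul1r.
    by elim: (m) => [|n IH]; rewrite ?e0 // eS0.
  rewrite big_ord_recl big1 ?addr0 => [|t _]; last first.
    by rewrite (state_sumE _ _ e0 eS0 eSS) //= if_same.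
  rewrite (state_sumE _ _ e0 eS0 eSS) //=.
  suff -> : forall n, e n 0 (bump 0 h) = 0 by rewrite if_same mul0r.
  by elim=> [|n IH]; rewrite ?e0 // eS0.
apply: eq_bigr => s _; apply: eq_bigr => h _.
under eq_bigr => t _ do rewrite (state_sumE _ _ e0 eS0 eSS) //.
rewrite /G /bump /=; case: ifP => _; last by rewrite big1 // mul0r.
rewrite big_ord_recl /= [X in _ = (_ + X) * _]big_mkcond /=; congr ((_ + _) * _).
by apply: eq_bigr => t _; rewrite /bump /= add1n /= ltn_ord.
Qed.

End General.

(** Closed forms for words that do not begin inside a run, with b and a restricted respectively. At
    [N = s] and [h = 0] only the alternating word remains, and the power of [Q] is its [maj]; [gbin]
    places the runs and [rc] distributes their lengths. *)
Definition eb N s h : C := Q ^+ (s * s.-1) * gbin Q N s * rc s h.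
Definition ea N s h : C := Q ^+ (s ^ 2 + h) * gbin Q N s * rc s h.

Lemma eb_window N s h :
  \sum_(t < r | (t <= h)%N) Q ^+ (N + s + (h - t))%N * eb N s (h - t)%N
  = Q ^+ (N - s) * Q ^+ (s.+1 * s) * gbin Q N s * rc s.+1 h.
Proof.
(* For [N < s] both sides vanish; this case is separated because [N - s] is truncated. *)
case: (leqP s N) => sN; last first.
  rewrite gbin_small // mulr0 mul0r big1 // => t _.
  by rewrite /eb gbin_small // mulr0 mul0r mulr0.
rewrite /= big_distrr; apply: eq_bigr => t _ /=; rewrite /eb !mulrA.
have -> : Q ^+ (N + s + (h - t)) * Q ^+ (s * s.-1)
    = Q ^+ (N - s) * Q ^+ (s.+1 * s) * Q ^+ (h - t).
  by rewrite -!exprD; congr (_ ^+ _); case: s sN => [|s] sN /=; nia.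
ring.
Qed.

Lemma ea_window N s h :
  \sum_(t < r | (t <= h)%N) 1 * ea N s (h - t)%N
  = Q ^+ (s ^ 2) * gbin Q N s * rc s.+1 h.
Proof.
rewrite /= big_distrr; apply: eq_bigr => t _ /=; rewrite /ea exprD; ring.
Qed.

(** Words beginning outside and inside a run combine by one q-Pascal step, whence the upper entry
    [N.+1]. *)
Lemma eb_total N s h : eb N s.+1 h +
  \sum_(t < r | (t <= h)%N) Q ^+ (N + s + (h - t))%N * eb N s (h - t)%N
  = Q ^+ (s.+1 * s) * gbin Q N.+1 s.+1 * rc s.+1 h.
Proof. rewrite eb_window gbin_rec // /eb [s.+1.-1]/=; ring. Qed.

Lemma gbin0n s : gbin Q 0 s = (s == 0)%:R.
Proof. by case: s => [|s]; rewrite ?gbin0 // gbin_small. Qed.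

Lemma words_total_b m (x y : C) :
  \sum_(w <- words m | short_runs true r w)
     Q ^+ maj w * (x ^+ count_mem false w * y ^+ count_mem true w)
  = x ^+ m + \sum_(s < m) \sum_(h < m.+1)
      if (s.+1 + h <= m)%N then
        Q ^+ (s.+1 * s) * gbin Q (m - (s.+1 + h)).+1 s.+1 * rc s.+1 h
        * (x ^+ (m - (s.+1 + h)) * y ^+ (s.+1 + h))
      else 0.
Proof.
under eq_bigr => w _ do rewrite -wordq_majb.
rewrite (@words_total true _ _ eb).
- congr (_ + _); apply: eq_bigr => s _; apply: eq_bigr => h _.
  by rewrite eb_total.
- move=> s h; rewrite /eb gbin0n; case: s => [|s]; rewrite ?mulr0 ?mul0r //.
  by rewrite muln0 expr0 !mul1r.
- by move=> N h; rewrite /eb !gbin0.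
- move=> N s h; rewrite mul1r eb_total /eb; congr (_ * _ * _).
Qed.

(** Here the two kinds of words stay apart: the binomial with lower entry [s] comes from words
    beginning inside a run, the one with [s.+1] from the remaining words. *)
Lemma words_total_a m (x y : C) :
  \sum_(w <- words m | short_runs false r w)
     Q ^+ maj w * (x ^+ count_mem false w * y ^+ count_mem true w)
  = y ^+ m + \sum_(s < m) \sum_(h < m.+1)
      if (s.+1 + h <= m)%N then
        Q ^+ (s ^ 2) * (gbin Q (m - (s.+1 + h)) s
          + Q ^+ (h + s.*2.+1) * gbin Q (m - (s.+1 + h)) s.+1) * rc s.+1 h
        * (x ^+ (s.+1 + h) * y ^+ (m - (s.+1 + h)))
      else 0.
Proof.
under eq_bigr => w _ do rewrite -wordq_maja [_ * y ^+ _]mulrC.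
rewrite (@words_total false _ _ ea).
- congr (_ + _); apply: eq_bigr => s _; apply: eq_bigr => h _.
  case: ifP => // _; rewrite ea_window [x ^+ _ * _]mulrC; congr (_ * _).
  rewrite /ea (_ : s.+1 ^ 2 + h = s ^ 2 + (h + s.*2.+1))%N; last by lia.
  rewrite exprD; ring.
- move=> s h; rewrite /ea gbin0n; case: s => [|s]; rewrite ?mulr0 ?mul0r //.
  by case: h => [|h] //=; rewrite ?mulr0 // expr0 !mul1r.
- by move=> N h; rewrite /ea !gbin0.
- move=> N s h; rewrite ea_window /ea gbin_rec //.
  case: (leqP s N) => sN; last first.
    by rewrite (gbin_small Q sN) (gbin_small Q (leqW sN)) !(mulr0, mul0r, addr0).
  have E : Q ^+ (N + s.+1 + h) * Q ^+ (s ^ 2) = Q ^+ (s.+1 ^ 2 + h) * Q ^+ (N - s).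
    by rewrite -!exprD; congr (_ ^+ _); lia.
  by rewrite !mulrA E; ring.
Qed.

End Totals.

(** * The right-hand sides as sums over words *)

Section RhsTerm.
Variables (R : realType) (mu nu q : R[i]) (a b k r : nat).
Hypothesis q_neq1 : forall n, q ^+ n.+1 != 1.
Hypothesis k_gt0 : (0 < k)%N.
Hypothesis r_gt0 : (0 < r)%N.
Local Notation Q := (q ^+ k).

Lemma rhs_termE m :
  rhs_term mu nu q a b k r m = (qpoch Q Q m)^-1 *
  \sum_(w <- words m | short_runs true r w)
    Q ^+ maj w * ((mu * q ^+ a) ^+ count_mem false w
                  * (nu * q ^+ b) ^+ count_mem true w).
Proof.
rewrite words_total_b //; last exact: qX_neq1.
rewrite /rhs_term; congr (_ * (_ + _)); first by rewrite exprMn -exprM mulnC.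
(* Terms with more restricted letters than parts vanish. This makes both sums finite and the
   remaining integer exponents natural. *)
have Z (s h : nat) : ~~ (s.+1 + h <= m)%N ->
    qbinom q k (m%:Z - h%:Z - s.+1%:Z + 1) s.+1%:Z = 0.
  by move=> smh; rewrite /qbinom ifF //; apply/negbTE; lia.
rewrite (@fsum_pos _ _ m) => [|s ms].
  apply: eq_bigr => s _; rewrite (@fsum_nat _ _ m.+1) => [|h mh].
    apply: eq_bigr => h _; case: ifPn => smh; last by rewrite Z // mulr0 mul0r.
    rewrite alt_sumE //; set N := (m - (s.+1 + h))%N.
    have -> : m%:Z - h%:Z - s.+1%:Z = N%:Z by rewrite /N; lia.
    rewrite (_ : N%:Z + 1 = N.+1%:Z); last by lia.
    rewrite qbinom_nat.
    rewrite (_ : _ + _ + _ = (N * a + (h + s.+1) * b + k * (s.+1 * s))%N%:Z :> int);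
      last by nia.
    rewrite -!exprnP !exprMn -!exprM !exprD.
    rewrite [(a * N)%N]mulnC [(b * _)%N]mulnC [(s.+1 + h)%N]addnC; ring.
  by rewrite Z ?mulr0 ?mul0r //; lia.
rewrite (@fsum_nat _ _ 0) ?big_ord0 // => h _.
by case: s ms => // s ms; rewrite Z ?mulr0 ?mul0r //; lia.
Qed.

Lemma rhs_term'E m :
  rhs_term' mu nu q a b k r m = (qpoch Q Q m)^-1 *
  \sum_(w <- words m | short_runs false r w)
    Q ^+ maj w * ((mu * q ^+ a) ^+ count_mem false w
                  * (nu * q ^+ b) ^+ count_mem true w).
Proof.
rewrite words_total_a //; last exact: qX_neq1.
rewrite /rhs_term'; congr (_ * (_ + _)); first by rewrite exprMn -exprM mulnC.
have Z (s h : nat) (B : int) : (0 <= B) -> ~~ (s.+1 + h <= m)%N ->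
    qbinom q k (m%:Z - h%:Z - s.+1%:Z) B = 0.
  by move=> B0 smh; rewrite /qbinom ifF //; apply/negbTE; lia.
rewrite (@fsum_pos _ _ m) => [|s ms].
  apply: eq_bigr => s _; rewrite (@fsum_nat _ _ m.+1) => [|h mh].
    apply: eq_bigr => h _; case: ifPn => smh.
      rewrite alt_sumE //; set N := (m - (s.+1 + h))%N.
      have -> : m%:Z - h%:Z - s.+1%:Z = N%:Z by rewrite /N; lia.
      rewrite (_ : s.+1%:Z - 1 = s%:Z); last by lia.
      rewrite !qbinom_nat.
      rewrite (_ : k%:Z * (_ + _ - _) = (k * (h + s.*2.+1))%N%:Z :> int); last by nia.
      rewrite (_ : _ + _ + _ = ((h + s.+1) * a + N * b + k * s ^ 2)%N%:Z :> int); last by nia.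
      rewrite -!exprnP !exprMn -!exprM !exprD.
      rewrite [(a * _)%N]mulnC [(b * N)%N]mulnC [(s.+1 + h)%N]addnC; ring.
    by rewrite !Z ?mulr0 ?addr0 ?mulr0 ?mul0r //; lia.
  by rewrite !Z ?mulr0 ?addr0 ?mulr0 ?mul0r //; lia.
rewrite (@fsum_nat _ _ 0) ?big_ord0 // => h _.
by case: s ms => // s ms; rewrite !Z ?mulr0 ?addr0 ?mulr0 ?mul0r //; lia.
Qed.

End RhsTerm.

(** * Partitions with a prescribed word *)

(** The default [~~ c] makes every position beyond the end break the run. *)
Lemma leq_lrun c n w :
  (n <= lrun c w)%N <-> (forall j, (j < n)%N -> nth (~~ c) w j = c).
Proof.
elim: w n => [|x w IH] n /=.
  rewrite leqn0; split => [/eqP -> //|]; case: n => // n /(_ 0%N isT).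
  by rewrite nth_nil; case: c.
case: (x =P c) => [->|xc]; last first.
  by rewrite leqn0; split => [/eqP -> //|]; case: n => // n /(_ 0%N isT).
case: n => // n; rewrite ltnS; split.
  by move=> /IH H [|j] //= jn; apply: H.
by move=> H; apply/IH => j jn; apply: (H j.+1).
Qed.

Lemma short_runsP c r w :
  short_runs c r w <->
  (forall i, ~ forall j, (j <= r)%N -> nth (~~ c) w (i + j) = c).
Proof.
elim: w => [|x w IH] /=.
  split=> // _ i /(_ 0%N isT); rewrite nth_nil; by case: c.
split.
  move=> /andP[l1 /IH H] [|i] H'; last by apply: (H i) => j /H'.
  move: l1; rewrite leqNgt => /negP; apply.
  by apply/(@leq_lrun c r.+1 (x :: w)) => j; rewrite ltnS => /H'.
move=> H; apply/andP; split.
  rewrite leqNgt; apply/negP => /(@leq_lrun c r.+1 (x :: w)) H'.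
  by apply: (H 0%N) => j jr; apply: H'.
by apply/IH => i H'; apply: (H i.+1) => j /H'.
Qed.

Section Partitions.
Variables (k a b : nat).
Hypotheses (hkb : (b <= k)%N) (hba : (a < b)%N) (ha : (1 <= a)%N).

Definition isb (z : nat) : bool := (z == b %[mod k])%N.
Definition part_ok (z : nat) : bool :=
  (0 < z)%N && ((z == a %[mod k])%N || (z == b %[mod k])%N).
Definition letter (x : bool) : nat := if x then b else a.
Definition incr (p : seq nat) : bool := sorted leq p && all part_ok p.
(** Parts are listed increasingly, so that inserting a new smallest part is [cons]. *)
Definition parts_word (w : seq bool) : set (seq nat) :=
  [set p | incr p /\ map isb p = w].
Local Notation shift := (map (addn k)).

Lemma k_gt0 : (0 < k)%N. Proof. lia. Qed.

Lemma ab_mod : (a == b %[mod k])%N = false.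
Proof.
apply/negbTE/negP; rewrite (modn_small (leq_trans hba hkb)) => /eqP E.
have [bk|bk] := ltnP b k; first by move: E; rewrite modn_small //; lia.
by move: E; rewrite (_ : b = k) ?modnn; lia.
Qed.

Lemma isb_letter x : isb (letter x) = x.
Proof. by case: x; rewrite /isb /= ?eqxx ?ab_mod. Qed.

Lemma part_ok_letter x : part_ok (letter x).
Proof. by case: x; rewrite /part_ok /= eqxx ?orbT andbT //; lia. Qed.

Lemma letter_lek x : (letter x <= k)%N.
Proof. by case: x => /=; lia. Qed.

Lemma isb_shift z : isb (k + z) = isb z.
Proof. by rewrite /isb modnDl. Qed.

Lemma part_ok_shift z : (0 < z)%N -> part_ok (k + z) = part_ok z.
Proof. by move=> z0; rewrite /part_ok !modnDl z0 addn_gt0 z0 orbT. Qed.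

Lemma part_ok_mod z : part_ok z -> (z == letter (isb z) %[mod k])%N.
Proof. by rewrite /part_ok -/(isb z) => /andP[_]; case E: (isb z) => /=; rewrite ?orbF. Qed.

Lemma eqmod_letter z x : part_ok z -> (z == letter x %[mod k])%N = (isb z == x).
Proof.
move=> /part_ok_mod /eqP ->; case: (isb z); case: x => //=; rewrite ?eqxx ?ab_mod //.
by rewrite eq_sym ab_mod.
Qed.

Lemma small_part z : part_ok z -> (z <= k)%N -> z = letter (isb z).
Proof.
move=> ok zk; have z0 : (0 < z)%N by case/andP: ok.
(* A number between 1 and [k] is recovered from its residue, with [k] standing for residue 0; this
   covers [b = k]. *)
have M (n : nat) : (0 < n)%N -> (n <= k)%N -> n = (if n %% k == 0 then k else n %% k)%N.
  move=> n0 nk; have [nk'|nk'] := ltnP n k.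
    by rewrite modn_small // ifF //; apply/negbTE; rewrite -lt0n.
  by have -> : n = k by [lia]; rewrite modnn.
have l0 : (0 < letter (isb z))%N by case: (isb z) => /=; lia.
by have := M _ l0 (letter_lek _); rewrite -(eqP (part_ok_mod ok)) -(M z z0 zk) => ->.
Qed.

Lemma letter_le z : part_ok z -> (letter (isb z) <= z)%N.
Proof.
move=> ok; have [zk|zk] := leqP z k; first by rewrite -(small_part ok zk).
exact: leq_trans (letter_lek _) (ltnW zk).
Qed.

Lemma shift_parts_wordP w p : (shift @` parts_word w) p <->
  parts_word w p /\ all (fun z => k < z)%N p.
Proof.
split => [[{}p [/andP[sp okp] pw] <-]|[[/andP[sp okp] pw] gp]] /=.
  split; [split|].
  - rewrite /incr sorted_map (eq_sorted (leq_add2l k)) sp /= all_map.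
    by apply: sub_all okp => z okz /=; rewrite part_ok_shift //; case/andP: okz.
  - by rewrite -map_comp -pw; apply: eq_map => z /=; rewrite isb_shift.
  - rewrite all_map; apply: sub_all okp => z /andP[z0 _] /=; lia.
have K : shift (map (subn^~ k) p) = p.
  rewrite -map_comp -[RHS]map_id; apply/eq_in_map => z /(allP gp) zk /=.
  by rewrite subnKC // ltnW.
exists (map (subn^~ k) p) => //; rewrite -K in sp okp pw; split.
- move: sp okp; rewrite /incr sorted_map (eq_sorted (leq_add2l k)) => -> /=.
  rewrite !all_map => H; apply/allP => z zp /=.
  have zk := allP gp z zp; have := allP H z zp; rewrite /= part_ok_shift //.
  by rewrite subn_gt0.
- by rewrite -pw -!map_comp; apply: eq_map => z /=; rewrite isb_shift.
Qed.

Lemma parts_word_nil : parts_word [::] = [set [::]].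
Proof. by apply/seteqP; split => [[|z p] [_ //]|p /= ->]. Qed.

Definition above (x : bool) (w : seq bool) : set (seq nat) :=
  [set p | parts_word w p /\ path leq (letter x) p].

(** A part congruent to a and at least [b] exceeds [a], hence exceeds [k]; so placing [b] below it
    forces a shift of all parts. In every other case the least part of the next class already
    suffices. This produces the terms of [maj]. *)
Lemma aboveE x w : above x w =
  if x && ~~ head true w then shift @` parts_word w else parts_word w.
Proof.
case: ifP => H; apply/seteqP; split => p.
- case: x w H => // -[|[] w] // _ [pw].
  case: p pw => [|z p] pw; first by case: pw.
  move=> /andP[/= bz zp].
  apply/shift_parts_wordP; split => //=.
  have [/andP[_ /= /andP[okz _]] [zb _]] := pw.
  have kz : (k < z)%N.
    rewrite ltnNge; apply/negP => /(small_part okz); rewrite zb /=; lia.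
  rewrite kz /=; apply/allP => y yp; apply: leq_trans kz _.
  by have := order_path_min leq_trans zp => /allP /(_ _ yp).
- move=> /shift_parts_wordP [pw gp]; split => //; have [/andP[sp _] _] := pw.
  rewrite path_min_sorted //; apply/allP => z /(allP gp) /ltnW.
  exact: leq_trans (letter_lek _).
- by case.
- move=> pw; split => //; have [/andP[sp okp] pww] := pw.
  case: p sp okp pww {pw} => //= z p sp /andP[okz _] zw; rewrite sp andbT.
  apply: leq_trans (letter_le okz); move: H; rewrite -zw /=.
  by case: x; case: (isb z) => //= _; lia.
Qed.

(** The smallest part either exceeds [k], and then all parts do, or it is the least member of its
    class. *)
Lemma parts_word_cons x w : parts_word (x :: w) =
  shift @` parts_word (x :: w) `|` cons (letter x) @` above x w.
Proof.
apply/seteqP; split => [p pw|p].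
  case: p pw => [[]//|z p] pw; have [/andP[/= zp /andP[okz okp]] [zx pw']] := pw.
  have [zk|kz] := leqP z k.
    right; exists p; last by rewrite (small_part okz zk) zx.
    split; last by rewrite -zx -(small_part okz zk).
    by split=> //; rewrite /incr okp (path_sorted zp).
  left; apply/shift_parts_wordP; split => //=; rewrite kz /=.
  apply/allP => y yp; apply: leq_trans kz _.
  by have := order_path_min leq_trans zp => /allP /(_ _ yp).
case; first by case/shift_parts_wordP.
case=> p' [[/andP[sp okp] pw] lp] <-; split; last by rewrite /= isb_letter pw.
by rewrite /incr /= lp part_ok_letter okp.
Qed.

Section WordSum.
Variables (R : realType) (mu nu q : R[i]).
Hypothesis q_neq1 : forall n, q ^+ n.+1 != 1.
Local Notation wt := (weight mu nu q a b k).
Local Notation Q := (q ^+ k).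

Lemma weight_cons x p :
  wt (letter x :: p) = (if x then nu * q ^+ b else mu * q ^+ a) * wt p.
Proof.
rewrite /weight /npartsmod /=; case: x => /=; rewrite !eqxx.
  rewrite [(b == a %[mod k])%N]eq_sym ab_mod add0n !exprD; ring.
rewrite ab_mod add0n !exprD; ring.
Qed.

Lemma weight_shift p : wt (shift p) = Q ^+ size p * wt p.
Proof.
rewrite /weight /npartsmod.
have E d : count (fun x => x == d %[mod k])%N (shift p) = count (fun x => x == d %[mod k])%N p.
  by rewrite count_map; apply: eq_count => z /=; rewrite modnDl.
rewrite !E; have -> : sumn (shift p) = (k * size p + sumn p)%N.
  by elim: p {E} => [|z p /= ->]; rewrite /= ?muln0 // mulnS; lia.
rewrite exprD exprM; ring.
Qed.

Definition word_weight w : R[i] :=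
  Q ^+ maj w * ((mu * q ^+ a) ^+ count_mem false w
                * (nu * q ^+ b) ^+ count_mem true w).

Lemma has_sum_shift w l :
  has_sum (parts_word w) wt l ->
  has_sum (shift @` parts_word w) wt (Q ^+ size w * l).
Proof.
move=> H; apply: (has_sum_reindex (psi := map (subn^~ k))).
  move=> p; rewrite -map_comp -[RHS]map_id; apply: eq_map => z /=.
  by rewrite addKn.
apply: eq_has_sum (has_sumZ (Q ^+ size w) H) => p [_ <-].
by rewrite weight_shift size_map.
Qed.

(** The decomposition [parts_word_cons] gives a linear equation for the sum, whose solution brings
    in the factor [1 - Q ^+ (size w).+1] of [qpoch]. Summability must be known beforehand; [P] will
    be [short_runs], which passes to tails. *)
Lemma has_sum_parts_word (P : pred (seq bool)) w :
  (forall x w', P (x :: w') -> P w') ->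
  (forall w', P w' -> exists l, has_sum (parts_word w') wt l) ->
  P w -> has_sum (parts_word w) wt (word_weight w / qpoch Q Q (size w)).
Proof.
move=> PS Psum; have Qn := qX_neq1 q_neq1 k_gt0.
elim: w => [|x w IH] Pw.
  rewrite parts_word_nil (_ : _ / _ = wt [::]); first exact: has_sum1.
  by rewrite /word_weight /weight /qpoch /= big_ord0 !expr0 !mulr1 divr1.
have [l Hl] := Psum _ Pw; have {}IH := IH (PS _ _ Pw).
pose f := if x && ~~ head true w then Q ^+ size w else 1.
have Ha : has_sum (above x w) wt (f * (word_weight w / qpoch Q Q (size w))).
  rewrite aboveE /f; case: ifP => _; last by rewrite mul1r.
  exact: has_sum_shift.
pose g := if x then nu * q ^+ b else mu * q ^+ a.
have Hc : has_sum (cons (letter x) @` above x w) wt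
    (g * (f * (word_weight w / qpoch Q Q (size w)))).
  refine (@has_sum_reindex _ _ _ (cons (letter x)) behead _ _ _ _ _); first by [].
  by apply: eq_has_sum (has_sumZ g Ha) => p _; rewrite weight_cons.
have := has_sumU _ (has_sum_shift Hl) Hc; rewrite -parts_word_cons => H.
have E : l = Q ^+ (size w).+1 * l + g * (f * (word_weight w / qpoch Q Q (size w))).
  (* The two pieces are disjoint: shifted parts exceed [k], while [letter x] does not. *)
  apply: has_sum_unique Hl (H _) => p [].
  move=> /shift_parts_wordP[_ gp] [p' _ pE]; move: gp; rewrite -pE /=.
  by case/andP; rewrite ltnNge letter_lek.
suff -> : word_weight (x :: w) / qpoch Q Q (size (x :: w)) = l by [].
have n1 := subXn_neq0 Qn (size w); have n2 := qpoch_neq0 Qn (size w).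
rewrite [size _]/= qpochS.
apply/esym/(mulIf n1); rewrite mulrBr mulr1 [l * _]mulrC {1}E addrAC subrr add0r.
have -> : word_weight (x :: w) = g * f * word_weight w.
  rewrite /word_weight /= !exprD /f /g; case: x {Pw Hl Ha Hc H E f g} => /=.
    case: (head true w); rewrite /= ?expr0 ?expr1; ring.
  by rewrite ?expr0 ?expr1; ring.
by field; rewrite n1 n2.
Qed.

End WordSum.
End Partitions.

(** * Absolute convergence *)

Lemma prod_count_mem (K : comPzRingType) (f : nat -> K) n (p : seq nat) :
  all (fun z => z < n)%N p ->
  \prod_(z <- p) f z = \prod_(z < n) f z ^+ count_mem (z : nat) p.
Proof.
elim: p => [|z p IH] /=; first by rewrite big_nil big1.
move=> /andP[zn /IH E]; rewrite big_cons E.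
under [RHS]eq_bigr => i _ do rewrite exprD.
rewrite big_split /=; congr (_ * _).
rewrite (bigD1 (Ordinal zn)) //= eqxx expr1 big1 ?mulr1 // => i.
by rewrite -val_eqE /= eq_sym => /negPf ->.
Qed.

Lemma geometric_le (R : realFieldType) (x : R) n : 0 <= x -> x < 1 ->
  \sum_(i < n) x ^+ i <= (1 - x)^-1.
Proof.
move=> x0 x1; have x1' : 0 < 1 - x by rewrite subr_gt0.
rewrite -[leRHS]mul1r ler_pdivlMr // mulrC -opprB mulNr -subrX1 opprB.
by rewrite gerBl exprn_ge0.
Qed.

Lemma prod_1D_le_expR (R : realType) n (f : nat -> R) :
  (forall i, 0 <= f i) ->
  \prod_(i < n) (1 + f i) <= expR (\sum_(i < n) f i).
Proof.
move=> f0; rewrite expR_sum; apply: ler_prod => i _.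
by rewrite expR_ge1Dx addr_ge0.
Qed.

Lemma count_le_lrun (t : nat -> bool) c z p :
  t z = c -> path leq z p -> (count_mem z p <= lrun c (map t p))%N.
Proof.
move=> tz; elim: p => //= y p IH /andP[zy yp]; rewrite eq_sym.
case: (z =P y) => [E|/eqP ne].
  by rewrite -E tz eqxx add1n ltnS IH // E.
rewrite add0n (_ : count_mem z p = 0%N) //; apply/count_memPn/negP => zp.
have /allP /(_ _ zp) := order_path_min leq_trans yp.
by move=> yz; move/negP: ne; apply; rewrite eqn_leq zy.
Qed.

(** Equal parts are adjacent in a sorted list, so a multiplicity is at most the length of a run. *)
Lemma short_runs_count (t : nat -> bool) c r z p :
  t z = c -> sorted leq p -> short_runs c r (map t p) -> (count_mem z p <= r)%N.
Proof.
move=> tz; elim: p => // x p IH xp /andP[l1 l2].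
have [E|ne] := eqVneq x z; last first.
  by rewrite /= (negPf ne) IH // (path_sorted xp).
apply: leq_trans l1; apply: count_le_lrun => //=.
by rewrite E leqnn -E.
Qed.

Section Summability.
Variables (R : realType) (mu nu q : R[i]) (k a b r : nat) (c : bool).
Hypotheses (hkb : (b <= k)%N) (hba : (a < b)%N) (ha : (1 <= a)%N).
Hypotheses (q_lt1 : normc q < 1).

Definition part_scale (x : bool) : R := if x then normc nu else normc mu.
Definition part_norm (z : nat) : R := part_scale (isb k b z) * normc q ^+ z.

Hypothesis free_lt1 : part_scale (~~ c) * normc q ^+ letter a b (~~ c) < 1.

Definition incr_short : set (seq nat) :=
  [set p | incr k a b p /\ short_runs c r (map (isb k b) p)].

Lemma part_scale_ge0 x : 0 <= part_scale x.
Proof. by case: x; exact: normc_ge0. Qed.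

Lemma part_norm_ge0 z : 0 <= part_norm z.
Proof. by rewrite mulr_ge0 ?part_scale_ge0 ?exprn_ge0 ?normc_ge0. Qed.

Lemma normc_weight p : all (part_ok k a b) p ->
  normc (weight mu nu q a b k p) = \prod_(z <- p) part_norm z.
Proof.
elim: p => [_|z p IH /= /andP[okz /IH E]].
  by rewrite big_nil /weight !expr0 !mulr1 normc1.
rewrite big_cons -E /weight /npartsmod /=.
rewrite (eqmod_letter hkb hba ha false okz) (eqmod_letter hkb hba ha true okz).
rewrite /part_norm /part_scale !normcM !normcX !exprD.
case: (isb k b z) => /=; rewrite ?expr0 ?expr1; ring.
Qed.

(** A consequence of short runs that constrains each value separately; relaxing to it lets the sum
    factor over values. *)
Definition mult_ok (z u : nat) : bool :=
  if part_ok k a b z then (isb k b z == c) ==> (u <= r)%N else u == 0.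

(** The first summand bounds the at most [r] positive powers of a restricted part, the second the
    geometric series of an unrestricted part, whose ratio is largest at the least member of its
    class. *)
Definition tail_const : R :=
  r%:R * (1 + part_scale c) ^+ r
  + part_scale (~~ c) / (1 - part_scale (~~ c) * normc q ^+ letter a b (~~ c)).

Lemma tail_const_ge0 : 0 <= tail_const.
Proof.
rewrite addr_ge0 ?mulr_ge0 ?ler0n ?exprn_ge0 ?invr_ge0 ?subr_ge0 ?part_scale_ge0 //.
  by rewrite addr_ge0 ?part_scale_ge0.
exact: ltW.
Qed.

Lemma part_factor_le z U : (r <= U)%N ->
  \sum_(u < U.+1 | mult_ok z u) part_norm z ^+ u <= 1 + tail_const * normc q ^+ z.
Proof.
move=> rU; have q0 := normc_ge0 q; have zq0 : 0 <= normc q ^+ z by rewrite exprn_ge0.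
have q1 : normc q ^+ z <= 1 by rewrite exprn_ile1 // ltW.
have s0 := part_scale_ge0 c; have s0' := part_scale_ge0 (~~ c).
have d0 : 0 < 1 - part_scale (~~ c) * normc q ^+ letter a b (~~ c) by rewrite subr_gt0.
have t1 : 0 <= r%:R * (1 + part_scale c) ^+ r.
  by rewrite mulr_ge0 ?ler0n ?exprn_ge0 ?addr_ge0.
have t2 : 0 <= part_scale (~~ c) / (1 - part_scale (~~ c) * normc q ^+ letter a b (~~ c)).
  by rewrite divr_ge0 // ltW.
rewrite /mult_ok; case okz: (part_ok k a b z); last first.
  rewrite (big_pred1 ord0) ?expr0 ?lerDl ?mulr_ge0 ?tail_const_ge0 //.
case: (isb k b z =P c) => [zc|/eqP zc] /=.
  under eq_bigl => u do rewrite -ltnS.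
  rewrite -(big_ord_widen U.+1 (fun u => part_norm z ^+ u)) //.
  rewrite big_ord_recl expr0 lerD2l /tail_const mulrDl.
  apply: (@le_trans _ _ (r%:R * (1 + part_scale c) ^+ r * normc q ^+ z)); last first.
    by rewrite lerDl mulr_ge0.
  rewrite -mulrA mulr_natl -[X in _ *+ X]card_ord -sumr_const.
  apply: ler_sum => i _; rewrite /part_norm zc exprMn.
  apply: ler_pM; rewrite ?exprn_ge0 ?mulr_ge0 //.
    (* The base is raised to at least 1 so that its powers increase up to exponent [r]. *)
    apply: (@le_trans _ _ ((1 + part_scale c) ^+ bump 0 i)).
      by apply: lerXn2r; rewrite ?nnegrE ?addr_ge0 // lerDr.
    by apply: ler_weXn2l; [rewrite lerDl|exact: ltn_ord].
  by rewrite lift0 exprS ler_piMr // exprn_ile1.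
have zc' : isb k b z = ~~ c by case: (isb k b z) zc; case: c.
have le1 : part_norm z <= part_scale (~~ c) * normc q ^+ letter a b (~~ c).
  rewrite /part_norm zc' ler_wpM2l // ler_wiXn2l //; first exact: ltW.
  by rewrite -zc' (letter_le hkb hba ha).
have lt1 : part_norm z < 1 by apply: le_lt_trans free_lt1.
apply: le_trans (geometric_le _ (part_norm_ge0 z) lt1) _.
have p1 : 0 < 1 - part_norm z by rewrite subr_gt0.
have -> : (1 - part_norm z)^-1 = 1 + part_norm z / (1 - part_norm z).
  by field; rewrite gt_eqF.
rewrite lerD2l /tail_const mulrDl.
apply: (@le_trans _ _ (part_norm z / (1 - part_scale (~~ c) * normc q ^+ letter a b (~~ c)))).
  rewrite ler_wpM2l ?part_norm_ge0 // lef_pV2 ?posrE //; lra.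
rewrite {1}/part_norm zc' mulrAC lerDr mulr_ge0 //.
Qed.

Lemma incr_short_bounded (F : {fset seq nat}) :
  \sum_(p <- F | p \in incr_short) normc (weight mu nu q a b k p)
  <= expR (tail_const / (1 - normc q)).
Proof.
(* [n] exceeds every part and [U] bounds every multiplicity occurring in [F], with [r <= U] as
   [part_factor_le] requires. The final bound depends on neither. *)
pose n := (\max_(p <- F) \max_(z <- p) z).+1%N.
pose U := (r + \max_(p <- F) size p)%N.
pose phi (p : seq nat) : {ffun 'I_n -> 'I_U.+1} :=
  [ffun z : 'I_n => inord (count_mem (z : nat) p)].
pose G (f : {ffun 'I_n -> 'I_U.+1}) : R :=
  \prod_(z < n) (if mult_ok z (f z) then part_norm z ^+ f z else 0).
have ltn_part p z : p \in F -> z \in p -> (z < n)%N.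
  move=> pF zp; rewrite ltnS.
  by apply: (bigmaxn_sup_seq _ pF) => //; apply: (bigmaxn_sup_seq _ zp).
have phiE p (z : 'I_n) : p \in F -> phi p z = count_mem (z : nat) p :> nat.
  move=> pF; rewrite ffunE inordK // ltnS (leq_trans (count_size _ _)) //.
  by apply: leq_trans (leq_addl _ _); apply: (bigmaxn_sup_seq _ pF).
have GE p : p \in F -> p \in incr_short ->
    normc (weight mu nu q a b k p) = G (phi p).
  move=> pF /set_mem [/andP[sp okp] rp].
  rewrite normc_weight // (@prod_count_mem _ _ n); last first.
    by apply/allP => z; exact: ltn_part.
  apply: eq_bigr => z _; rewrite phiE // ifT // /mult_ok.
  case: ifP => okz; first by apply/implyP => /eqP zc; exact: short_runs_count zc sp rp.
  by apply/eqP/count_memPn; apply/negP => /(allP okp); rewrite okz.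
have phi_inj : {in [seq p <- F | p \in incr_short] &, injective phi}.
  move=> p p'; rewrite !mem_filter => /andP[/set_mem [/andP[sp _] _] pF].
  move=> /andP[/set_mem [/andP[sp' _] _] pF'] E.
  apply: (sorted_eq leq_trans anti_leq sp sp'); apply/allP => z _ /=; apply/eqP.
  have [zn|zn] := ltnP z n.
    by rewrite -(phiE p (Ordinal zn)) // E phiE.
  rewrite !(count_memPn _) //; apply/negP => zp.
    by have := ltn_part _ _ pF' zp; rewrite ltnNge zn.
  by have := ltn_part _ _ pF zp; rewrite ltnNge zn.
have G0 f : 0 <= G f.
  by apply: prodr_ge0 => z _; case: ifP => // _; rewrite exprn_ge0 ?part_norm_ge0.
rewrite -big_filter big_seq (eq_bigr (fun p => G (phi p))); last first.
  by move=> p; rewrite mem_filter => /andP[pA pF]; exact: GE.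
rewrite -big_seq -(big_map phi xpredT) /=.
apply: (@le_trans _ _ (\sum_(f <- index_enum {ffun 'I_n -> 'I_U.+1}) G f)).
  apply: ler_sum_subset => //; last by move=> f _; rewrite mem_index_enum.
  by rewrite map_inj_in_uniq // filter_uniq // fset_uniq.
(* Distributivity turns the sum over all multiplicity functions into a product over part values. *)
rewrite /G -(bigA_distr_bigA (fun (z : 'I_n) (u : 'I_U.+1) =>
  if mult_ok z u then part_norm z ^+ u else 0)).
apply: (@le_trans _ _ (\prod_(z < n) (1 + tail_const * normc q ^+ z))).
  apply: ler_prod => z _; apply/andP; split.
    by apply: sumr_ge0 => u _; case: ifP => // _; rewrite exprn_ge0 ?part_norm_ge0.
  by rewrite -big_mkcond part_factor_le // leq_addr.
apply: le_trans (prod_1D_le_expR (f := fun z => tail_const * normc q ^+ z) _ _) _.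
  by move=> z; rewrite mulr_ge0 ?tail_const_ge0 ?exprn_ge0 ?normc_ge0.
rewrite ler_expR -big_distrr /= ler_wpM2l ?tail_const_ge0 //.
by rewrite geometric_le ?normc_ge0.
Qed.

End Summability.

(** * The identities *)

Section Assembly.
Variables (R : realType) (mu nu q : R[i]) (k a b r : nat) (c : bool).
Hypotheses (hkb : (b <= k)%N) (hba : (a < b)%N) (ha : (1 <= a)%N).
Hypotheses (q_lt1 : normc q < 1).
Hypothesis free_lt1 :
  part_scale mu nu (~~ c) * normc q ^+ letter a b (~~ c) < 1.
Local Notation wt := (weight mu nu q a b k).
Local Notation Q := (q ^+ k).

Lemma restricted_partitionsE :
  restricted_partitions a b k r (letter a b c) = rev @` incr_short k a b r c.
Proof.
have parts_okE p : all (part_ok k a b) p <-> all (fun x => 0 < x)%N p /\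
    forall x, x \in p -> (x = a %[mod k] \/ x = b %[mod k])%N.
  split=> [/allP H|[/allP H0 H]].
    split; first by apply/allP => x /H /andP[].
    by move=> x /H /andP[_ /orP[/eqP|/eqP]]; [left|right].
  apply/allP => x xp; rewrite /part_ok H0 //=.
  by case: (H x xp) => ->; rewrite eqxx ?orbT.
suff E p : restricted_partitions a b k r (letter a b c) p <-> incr_short k a b r c (rev p).
  apply/seteqP; split=> [p /E H|_ [p H <-]]; first by exists (rev p); rewrite ?revK.
  by apply/E; rewrite revK.
have nthE i : all (part_ok k a b) p -> (i < size p)%N ->
    nth (~~ c) (map (isb k b) (rev p)) i = c
    <-> (nth 0 p (size p - i.+1) = letter a b c %[mod k])%N.
  move=> okp ip; rewrite (nth_map 0%N) ?size_rev // nth_rev //.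
  have ok : part_ok k a b (nth 0%N p (size p - i.+1)).
    by apply: (allP okp); rewrite mem_nth // ltn_subrL (leq_ltn_trans _ ip).
  split=> [H|/eqP]; first by apply/eqP; rewrite (eqmod_letter hkb hba ha _ ok) H.
  by rewrite (eqmod_letter hkb hba ha _ ok) => /eqP.
rewrite /incr_short /incr /= rev_sorted all_rev /is_partition; split.
- case=> /andP[sp p0] pab nr; have okp : all (part_ok k a b) p by apply/parts_okE.
  split; first by rewrite okp andbT.
  apply/short_runsP => i H; apply: nr.
  have ir : (i + r < size p)%N.
    rewrite ltnNge; apply/negP => pi; have := H r (leqnn r).
    by rewrite nth_default ?size_map ?size_rev //; case: c.
  (* Reversal carries the window from [i] to [i + r] to the one starting here, traversed
     backwards. *)
  exists (size p - (i + r).+1)%N; split; first by lia.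
  move=> j jr; have -> : (size p - (i + r).+1 + j = size p - (i + (r - j)).+1)%N by lia.
  by apply/nthE; [|lia|apply: H; exact: leq_subr].
- case=> /andP[sp okp] /short_runsP H.
  have [p0 pab] := (parts_okE p).1 okp; split => //; first by apply/andP.
  case=> i [ir Hi]; apply: (H (size p - (i + r).+1)%N) => j jr.
  apply/nthE => //; first by lia.
  have -> : (size p - (size p - (i + r).+1 + j).+1 = i + (r - j))%N by lia.
  by apply: Hi; exact: leq_subr.
Qed.

Lemma weight_rev p : wt (rev p) = wt p.
Proof. by rewrite /weight /npartsmod !count_rev sumn_rev. Qed.

Lemma q_neq1 n : q ^+ n.+1 != 1.
Proof.
apply/eqP => /(congr1 (@normc R)); rewrite normcX normc1 => /eqP.
by rewrite lt_eqF // exprn_ilt1 ?normc_ge0.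
Qed.

(** Absolute convergence supplies [S] first; the sum is then regrouped by number of parts, and each
    group splits into finitely many words. *)
Lemma partition_sum (t : nat -> R[i]) :
  (forall m, t m = (qpoch Q Q m)^-1 *
    \sum_(w <- words m | short_runs c r w) word_weight k a b mu nu q w) ->
  exists S T : R[i],
    [/\ has_sum (restricted_partitions a b k r (letter a b c)) wt S,
        has_sum [set m : nat | (1 <= m)%N] t T & S = 1 + T].
Proof.
move=> tE; pose A := incr_short k a b r c.
have [M HM] : exists M, forall F : {fset seq nat},
    \sum_(p <- F | p \in A) normc (wt p) <= M.
  by eexists; apply: incr_short_bounded.
have [S HS] : exists S, has_sum A wt S by exact: abs_summable HM.
have Hw w : short_runs c r w ->
    has_sum (parts_word k a b w) wt (word_weight k a b mu nu q w / qpoch Q Q (size w)).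
  move=> rw; apply: (has_sum_parts_word hkb hba ha q_neq1 (P := short_runs c r)) => //.
  - by move=> x w' /andP[].
  (* The partitions with one admissible word form a subset of [A], so the bound [M] applies to
     them. *)
  move=> w' rw'; apply: (@abs_summable _ _ _ _ M) => F; apply: le_trans (HM F).
  rewrite -big_filter -[leRHS]big_filter; apply: ler_sum_subset.
  - by move=> p; exact: normc_ge0.
  - by rewrite filter_uniq ?fset_uniq.
  - move=> p; rewrite !mem_filter => /andP[/set_mem [ip pw] ->]; rewrite andbT.
    by apply: mem_set; split; rewrite // pw.
have Ht : has_sum setT t S.
  apply: (has_sum_fibration (g := size) HS) => m.
  rewrite tE mulrC big_distrl /= -big_filter.
  have -> : [set p | A p /\ size p = m] = [set p | A p /\
      map (isb k b) p \in [seq w <- words m | short_runs c r w]].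
    apply/seteqP; split=> p [Ap] /=; rewrite mem_filter mem_words size_map.
      by move=> ->; split => //; case: Ap => _ ->; rewrite eqxx.
    by move=> /andP[_ /eqP].
  apply: has_sum_fibres => [|w]; first by rewrite filter_uniq ?words_uniq.
  rewrite mem_filter mem_words => /andP[rw /eqP sw].
  rewrite (_ : [set x | _] = parts_word k a b w); first by rewrite -sw; exact: Hw.
  apply/seteqP; split=> p /=; first by case=> -[ip _] pw.
  by case=> ip pw; split=> //; split; rewrite // pw.
have t0 : t 0%N = 1.
  rewrite tE /qpoch big_ord0 invr1 mul1r /= big_mkcond big_seq1 /=.
  by rewrite /word_weight /= !expr0 !mulr1.
exists S, (S - 1); split; last by rewrite addrC subrK.
- rewrite restricted_partitionsE; apply: (has_sum_reindex (psi := rev)).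
    exact: revK.
  by apply: eq_has_sum HS => p _; rewrite weight_rev.
- refine (proj2 (has_sum_mkcond t _ (@subsetT _ [set m : nat | (1 <= m)%N])) _).
  (* Index 0, which accounts for the empty partition, is removed by subtracting a one-point
     family. *)
  have H1 := (has_sum_mkcond t (t 0%N) (@subsetT _ [set 0%N])).1 (@has_sum1 R _ t 0%N).
  have -> : S - 1 = S + (-1) * t 0%N by rewrite t0 mulr1.
  apply: eq_has_sum (has_sumD Ht (has_sumZ (-1) H1)) => m _.
  case: m => [|m].
    by rewrite [in LHS]mem_set // memNset //= mulN1r subrr.
  by rewrite [in LHS]memNset // mem_set //= mulr0 addr0.
Qed.

End Assembly.

(** The least part of the unrestricted class may repeat without bound, and the modulus condition is
    the convergence of its geometric series. Parts of the restricted class have multiplicity at most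
    [r]. *)
Theorem theorem1p4 (R : realType) (k a b r : nat) (mu nu q : R[i])
    (hkb : (b <= k)%N) (hba : (a < b)%N) (ha : (1 <= a)%N) (hr : (1 <= r)%N)
    (hq : `|q| < 1) :
  (`|mu * q ^+ a| < 1 ->
     exists S T : R[i],
       [/\ has_sum (Pset a b k r) (weight mu nu q a b k) S,
           has_sum [set m : nat | (1 <= m)%N] (rhs_term mu nu q a b k r) T
         & S = 1 + T]) /\
  (`|nu * q ^+ b| < 1 ->
     exists S T : R[i],
       [/\ has_sum (Pset' a b k r) (weight mu nu q a b k) S,
           has_sum [set m : nat | (1 <= m)%N] (rhs_term' mu nu q a b k r) T
         & S = 1 + T]).
Proof.
have k0 : (0 < k)%N by lia.
have q1 : normc q < 1 by move: hq; rewrite norm_normc ltcR.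
have qn := q_neq1 q1.
split; rewrite norm_normc ltcR normcM normcX => hx.
- by apply: (@partition_sum R mu nu q k a b r true) => // m; exact: rhs_termE.
- by apply: (@partition_sum R mu nu q k a b r false) => // m; exact: rhs_term'E.
Qed.
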